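(* Let $R$ be a superalgebra over $\mathbb Q$ and $(A,M)=\{(A_j,M_{j-\frac12})\}_{j\ge1}\in R^\infty=(R^0)^\infty\oplus(R^1)^\infty$. Then $$H(x,\varphi)=\exp\Big(-\sum_{j\ge1}\big(A_jL_j(x,\varphi)+M_{j-\frac12}G_{j-\frac12}(x,\varphi)\big)\Big)\cdot(x,\varphi)$$ is superconformal and is the unique formal superconformal power series in $R[[x]][\varphi]$ with even coefficient of $\varphi$ equal to one such that $$\varphi H(x,\varphi)=\varphi\Big(x+\sum_{j\ge1}E_j(A,M)x^{j+1},\ \sum_{j\ge1}E_{j-\frac12}(A,M)x^j\Big).$$
   Context: A superalgebra $R=R^0\oplus R^1$ over $\mathbb Q$ is a $\mathbb Z_2$-graded associative unital $\mathbb Q$-algebra with $ab=(-1)^{|a||b|}ba$ for homogeneous $a,b$. $x$ is an even formal variable (commuting with everything) and $\varphi$ an odd formal variable (commuting with $x$ and even elements, anticommuting with odd elements, $\varphi^2=0$). $R^\infty$ is the set of pairs of a sequence $\{A_j\}_{j\ge1}$ in $R^0$ and a sequence $\{M_{j-1/2}\}_{j\ge1}$ in $R^1$. For $j\in\mathbb Z$: $L_j(x,\varphi)=-\big(x^{j+1}\frac{\partial}{\partial x}+\frac{j+1}2\varphi x^j\frac{\partial}{\partial\varphi}\big)$, $G_{j-\frac12}(x,\varphi)=-x^j\big(\frac{\partial}{\partial\varphi}-\varphi\frac{\partial}{\partial x}\big)$. Operators act on pairs componentwise: $e^T\cdot(x,\varphi)=(e^T\cdot x,e^T\cdot\varphi)$.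 A formal series is written as a pair (even part, odd part) $H(x,\varphi)=(f(x)+\varphi\xi(x),\psi(x)+\varphi g(x))$ with $f,g$ having coefficients in $R^0$ and $\xi,\psi$ in $R^1$; it is (formally) superconformal if $\xi=g\psi$, $g^2=f'+\psi\psi'$ and $g+\varphi\psi'$ is not identically zero. Note $\varphi H=\varphi(f,\psi)$. The ''even coefficient of $\varphi$'' is the coefficient of the monomial $\varphi x^0$ in the odd part, i.e. $g(0)$. Definition of $E$: for even formal variables $\mathcal A_j$ and odd formal variables $\mathcal M_{j-1/2}$ ($j\ge1$), the elements $E_j(\mathcal A,\mathcal M)$ (even) and $E_{j-1/2}(\mathcal A,\mathcal M)$ (odd) of $\mathbb Q[\mathcal A,\mathcal M]$ are defined by $$\varphi\Big(x+\sum_{j\ge1}E_j(\mathcal A,\mathcal M)x^{j+1},\sum_{j\ge1}E_{j-\frac12}(\mathcal A,\mathcal M)x^j\Big)=\varphi\exp\Big(-\sum_{j\ge1}(\mathcal A_jL_j(x,\varphi)+\mathcal M_{j-\frac12}G_{j-\frac12}(x,\varphi))\Big)\cdot(x,\varphi),$$ and $E_j(A,M)$, $E_{j-1/2}(A,M)$ are obtained by substitution. *)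

(* Defs.v *)
From HB Require Import structures.
From mathcomp Require Import all_boot all_order all_algebra finmap monalg.
From mathcomp Require Import mathcomp_extra boolp classical_sets functions filter.

Set Implicit Arguments.
Unset Strict Implicit.
Unset Printing Implicit Defensive.

Import Order.TTheory GRing.Theory Num.Theory.
Local Open Scope ring_scope.

(* R^0 = homog false and R^1 = homog true; hpart b x is the component of x in
   R^b. *)
HB.mixin Record isSuperalgebra R of GRing.Algebra rat R := {
  homog : bool -> {pred R};
  hpart : bool -> R -> R;
  homog_submod : forall b, submod_closed (homog b);
  homog1 : 1 \in homog false;
  homogM : forall a b x y,
    x \in homog a -> y \in homog b -> x * y \in homog (a (+) b);
  hpart_homog : forall b x, hpart b x \in homog b;
  hpart_sum : forall x, x = hpart false x + hpart true x;
  homog_direct : forall x, x \in homog false -> x \in homog true -> x = 0;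
  supercomm : forall a b x y,
    x \in homog a -> y \in homog b -> x * y = (-1) ^+ (a && b) * (y * x)
}.

#[short(type="superAlgType")]
HB.structure Definition Superalgebra := {R of GRing.Algebra rat R & isSuperalgebra R}.

Section SuperalgebraTheory.
Variable R : superAlgType.
Implicit Types (x y : R) (b : bool).

Lemma homog0 b : (0 : R) \in homog b.
Proof. by case: (homog_submod (s := R) b). Qed.

Lemma homogZD b (c : rat) x y :
  x \in homog b -> y \in homog b -> c *: x + y \in homog b.
Proof. by case: (homog_submod (s := R) b) => _; apply. Qed.

Lemma homogD b x y : x \in homog b -> y \in homog b -> x + y \in homog b.
Proof. by move=> xb yb; rewrite -[x]scale1r homogZD. Qed.

Lemma homogZ b (c : rat) x : x \in homog b -> c *: x \in homog b.
Proof. by move=> xb; rewrite -[_ *: _]addr0 homogZD ?homog0. Qed.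

Lemma homogN b x : x \in homog b -> - x \in homog b.
Proof. by move=> xb; rewrite -scaleN1r homogZ. Qed.

Lemma hpart_unique x y0 y1 : y0 \in homog false -> y1 \in homog true ->
  x = y0 + y1 -> hpart false x = y0 /\ hpart true x = y1.
Proof.
move=> h0 h1 xE; have := hpart_sum x; rewrite {1}xE => e.
have d : hpart false x - y0 = y1 - hpart true x.
  by apply/eqP; rewrite subr_eq addrAC eq_sym subr_eq addrC e.
have z : hpart false x - y0 = 0.
  apply: homog_direct; first by rewrite homogD ?homogN ?hpart_homog.
  by rewrite d homogD ?homogN ?hpart_homog.
split; first by apply/eqP; rewrite -subr_eq0 z.
by apply/eqP; rewrite eq_sym -subr_eq0 -d z.
Qed.

(* The parity involution, for which x * phi = phi * spar x. *)
Definition spar x : R := hpart false x - hpart true x.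

Lemma spar_split x y0 y1 : y0 \in homog false -> y1 \in homog true ->
  x = y0 + y1 -> spar x = y0 - y1.
Proof. by move=> h0 h1 /(hpart_unique h0 h1)[e0 e1]; rewrite /spar e0 e1. Qed.

Lemma spar_even x : x \in homog false -> spar x = x.
Proof.
by move=> h; rewrite (spar_split h (homog0 true)) ?subr0 ?addr0.
Qed.

Lemma spar_odd x : x \in homog true -> spar x = - x.
Proof.
by move=> h; rewrite (spar_split (homog0 false) h) ?sub0r ?add0r.
Qed.

Lemma sparZD (c : rat) x y : spar (c *: x + y) = c *: spar x + spar y.
Proof.
rewrite (@spar_split _ (c *: hpart false x + hpart false y)
  (c *: hpart true x + hpart true y)) ?homogZD ?hpart_homog //.
  by rewrite /spar scalerBr opprD addrACA.
by rewrite {1}[x]hpart_sum {1}[y]hpart_sum scalerDr addrACA.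
Qed.

Lemma sparD x y : spar (x + y) = spar x + spar y.
Proof. by have := sparZD 1 x y; rewrite !scale1r. Qed.

Lemma spar0 : spar 0 = 0.
Proof. by rewrite spar_even ?homog0. Qed.

Lemma sparZ (c : rat) x : spar (c *: x) = c *: spar x.
Proof. by have := sparZD c x 0; rewrite !addr0 spar0 addr0. Qed.

Lemma spar1 : spar 1 = 1.
Proof. by rewrite spar_even ?homog1. Qed.

Lemma sparM x y : spar (x * y) = spar x * spar y.
Proof.
rewrite (@spar_split _
  (hpart false x * hpart false y + hpart true x * hpart true y)
  (hpart false x * hpart true y + hpart true x * hpart false y)).
- by rewrite /spar mulrBl !mulrBr opprB opprD addrACA.
- by apply: homogD; [apply: (@homogM R false false)
                    | apply: (@homogM R true true)];
     apply: hpart_homog.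
- by apply: homogD; [apply: (@homogM R false true)
                    | apply: (@homogM R true false)];
     apply: hpart_homog.
rewrite {1}[x]hpart_sum {1}[y]hpart_sum mulrDl !mulrDr.
by rewrite [X in _ + X]addrC addrACA.
Qed.

End SuperalgebraTheory.

Section Fps.
Variable R : algType rat.

Record fps := Fps { coef :> nat -> R }.

HB.instance Definition _ := [isNew for coef].
HB.instance Definition _ := [Choice of fps by <:].

Implicit Types f g h : fps.

Lemma fpsP f g : (forall n, f n = g n) -> f = g.
Proof. by move=> fg; apply: val_inj; apply/funext. Qed.

Definition fps_zero := Fps (fun=> 0).
Definition fps_opp f := Fps (fun n => - f n).
Definition fps_add f g := Fps (fun n => f n + g n).
Definition fps_scale (c : rat) f := Fps (fun n => c *: f n).
Definition fps_one := Fps (fun n => (n == 0%N)%:R).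
Definition fps_mul f g := Fps (fun n => \sum_(i < n.+1) f i * g (n - i)%N).

Lemma fps_addA : associative fps_add.
Proof. by move=> f g h; apply: fpsP => n /=; rewrite addrA. Qed.

Lemma fps_addC : commutative fps_add.
Proof. by move=> f g; apply: fpsP => n /=; rewrite addrC. Qed.

Lemma fps_add0 : left_id fps_zero fps_add.
Proof. by move=> f; apply: fpsP => n /=; rewrite add0r. Qed.

Lemma fps_addN : left_inverse fps_zero fps_opp fps_add.
Proof. by move=> f; apply: fpsP => n /=; rewrite addNr. Qed.

HB.instance Definition _ :=
  GRing.isZmodule.Build fps fps_addA fps_addC fps_add0 fps_addN.

Lemma fps_scaleA c d f : fps_scale c (fps_scale d f) = fps_scale (c * d) f.
Proof. by apply: fpsP => n /=; rewrite scalerA. Qed.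

Lemma fps_scale1 : left_id 1 fps_scale.
Proof. by move=> f; apply: fpsP => n /=; rewrite scale1r. Qed.

Lemma fps_scaleDr : right_distributive fps_scale +%R.
Proof. by move=> c f g; apply: fpsP => n /=; rewrite scalerDr. Qed.

Lemma fps_scaleDl f : {morph fps_scale^~ f : c d / c + d}.
Proof. by move=> c d; apply: fpsP => n /=; rewrite scalerDl. Qed.

HB.instance Definition _ := GRing.Zmodule_isLmodule.Build rat fps
  fps_scaleA fps_scale1 fps_scaleDr fps_scaleDl.

Let trunc n f : {poly R} := \poly_(i < n.+1) f i.

Let truncE n f i : (i <= n)%N -> (trunc n f)`_i = f i.
Proof. by move=> le; rewrite coef_poly ltnS le. Qed.

Let fps_mulE N f g n : (n <= N)%N ->
  fps_mul f g n = (trunc N f * trunc N g)`_n.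
Proof.
move=> le; rewrite coefM; apply: eq_bigr => i _.
by rewrite !truncE //; [exact: leq_trans (leq_subr _ _) le |
   exact: leq_trans (leq_ord i) le].
Qed.

Lemma fps_mulA : associative fps_mul.
Proof.
move=> f g h; apply: fpsP => n.
transitivity ((trunc n f * (trunc n g * trunc n h))`_n).
  rewrite coefM; apply: eq_bigr => i _.
  by rewrite truncE ?leq_ord // (@fps_mulE n) ?leq_subr.
rewrite mulrA coefM; apply: eq_bigr => i _.
by rewrite truncE ?leq_subr // (@fps_mulE n) ?leq_ord.
Qed.

Lemma fps_mul1 : left_id fps_one fps_mul.
Proof.
move=> f; apply: fpsP => n /=; rewrite big_ord_recl big1 ?addr0.
  by rewrite mul1r subn0.
by move=> i _; rewrite mul0r.
Qed.

Lemma fps_mulr1 : right_id fps_one fps_mul.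
Proof.
move=> f; apply: fpsP => n /=; rewrite big_ord_recr /= big1 ?add0r.
  by rewrite subnn mulr1.
by move=> i _; rewrite subn_eq0 leqNgt ltn_ord mulr0.
Qed.

Lemma fps_mulDl : left_distributive fps_mul +%R.
Proof.
move=> f g h; apply: fpsP => n /=; rewrite -big_split /=.
by apply: eq_bigr => i _; rewrite mulrDl.
Qed.

Lemma fps_mulDr : right_distributive fps_mul +%R.
Proof.
move=> f g h; apply: fpsP => n /=; rewrite -big_split /=.
by apply: eq_bigr => i _; rewrite mulrDr.
Qed.

Lemma fps_oner_neq0 : fps_one != 0.
Proof.
by apply/eqP => /(congr1 (fun f : fps => f 0%N)) /eqP; rewrite oner_eq0.
Qed.

HB.instance Definition _ := GRing.Zmodule_isNzRing.Build fps
  fps_mulA fps_mul1 fps_mulr1 fps_mulDl fps_mulDr fps_oner_neq0.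

Lemma fps_scaleAl (c : rat) f g : c *: (f * g) = c *: f * g.
Proof.
apply: fpsP => n /=; rewrite scaler_sumr.
by apply: eq_bigr => i _; rewrite scalerAl.
Qed.

Lemma fps_scaleAr (c : rat) f g : c *: (f * g) = f * (c *: g).
Proof.
apply: fpsP => n /=; rewrite scaler_sumr.
by apply: eq_bigr => i _; rewrite scalerAr.
Qed.

HB.instance Definition _ := GRing.Lmodule_isLalgebra.Build rat fps fps_scaleAl.
HB.instance Definition _ := GRing.Lalgebra_isAlgebra.Build rat fps fps_scaleAr.

Lemma fps_sumE (I : Type) (r : seq I) (P : pred I) (F : I -> fps) n :
  (\sum_(i <- r | P i) F i) n = \sum_(i <- r | P i) F i n.
Proof. by elim/big_rec2: _ => // i y x _ <-. Qed.

Definition fps_deriv f := Fps (fun n => f n.+1 *+ n.+1).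

End Fps.

Section Sseries.
Variable R : superAlgType.

(* R[[x]][phi]: SSeries a b stands for a(x) + phi b(x). *)
Record sseries := SSeries { cf0 : fps R; cf1 : fps R }.

Let sseries_pair F := (cf0 F, cf1 F).
Let pair_sseries (ab : fps R * fps R) := SSeries ab.1 ab.2.
Let sseries_pairK : cancel sseries_pair pair_sseries.
Proof. by case. Qed.

HB.instance Definition _ := Choice.copy sseries (can_type sseries_pairK).

Implicit Types F G K : sseries.

Definition fps_spar (f : fps R) : fps R := Fps (fun n => spar (f n)).

Definition sseries_zero := SSeries 0 0.
Definition sseries_opp F := SSeries (- cf0 F) (- cf1 F).
Definition sseries_add F G := SSeries (cf0 F + cf0 G) (cf1 F + cf1 G).
Definition sseries_scale (c : rat) F := SSeries (c *: cf0 F) (c *: cf1 F).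
Definition sseries_one := SSeries 1 0.
Definition sseries_mul F G :=
  SSeries (cf0 F * cf0 G) (cf1 F * cf0 G + fps_spar (cf0 F) * cf1 G).

Lemma sseries_addA : associative sseries_add.
Proof. by move=> F G K; rewrite /sseries_add /= !addrA. Qed.

Lemma sseries_addC : commutative sseries_add.
Proof. by move=> F G; congr SSeries; rewrite addrC. Qed.

Lemma sseries_add0 : left_id sseries_zero sseries_add.
Proof. by case=> a b; rewrite /sseries_add /= !add0r. Qed.

Lemma sseries_addN : left_inverse sseries_zero sseries_opp sseries_add.
Proof. by case=> a b; rewrite /sseries_add /= !addNr. Qed.

HB.instance Definition _ := GRing.isZmodule.Build sseries
  sseries_addA sseries_addC sseries_add0 sseries_addN.

Lemma sseries_scaleA c d F :
  sseries_scale c (sseries_scale d F) = sseries_scale (c * d) F.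
Proof. by rewrite /sseries_scale /= !scalerA. Qed.

Lemma sseries_scale1 : left_id 1 sseries_scale.
Proof. by case=> a b; rewrite /sseries_scale /= !scale1r. Qed.

Lemma sseries_scaleDr : right_distributive sseries_scale +%R.
Proof. by move=> c F G; congr SSeries; rewrite scalerDr. Qed.

Lemma sseries_scaleDl F : {morph sseries_scale^~ F : c d / c + d}.
Proof. by move=> c d; congr SSeries; rewrite scalerDl. Qed.

HB.instance Definition _ := GRing.Zmodule_isLmodule.Build rat sseries
  sseries_scaleA sseries_scale1 sseries_scaleDr sseries_scaleDl.

Let fps_sparD : {morph fps_spar : f g / f + g}.
Proof. by move=> f g; apply: fpsP => n; apply: sparD. Qed.

Let fps_sparZ (c : rat) : {morph fps_spar : f / c *: f}.
Proof. by move=> f; apply: fpsP => n; apply: sparZ. Qed.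

Let fps_sparM : {morph fps_spar : f g / f * g}.
Proof.
move=> f g; apply: fpsP => n /=.
rewrite (big_morph (@spar R) (@sparD R) (@spar0 R)).
by apply: eq_bigr => i _; rewrite sparM.
Qed.

Let fps_spar1 : fps_spar 1 = 1.
Proof. by apply: fpsP => -[|n] /=; rewrite ?spar0 ?spar1. Qed.

Lemma sseries_mulA : associative sseries_mul.
Proof.
case=> [a b] [c d] [e f]; congr SSeries => /=; first by rewrite mulrA.
by rewrite fps_sparM !mulrDl mulrDr !mulrA addrA.
Qed.

Lemma sseries_mul1 : left_id sseries_one sseries_mul.
Proof.
by case=> [a b]; rewrite /sseries_mul /= fps_spar1 !mul1r mul0r add0r.
Qed.

Lemma sseries_mulr1 : right_id sseries_one sseries_mul.
Proof. by case=> [a b]; rewrite /sseries_mul /= !mulr1 mulr0 addr0. Qed.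

Lemma sseries_mulDl : left_distributive sseries_mul +%R.
Proof.
case=> [a b] [c d] [e f]; congr SSeries => /=; first by rewrite mulrDl.
by rewrite fps_sparD !mulrDl addrACA.
Qed.

Lemma sseries_mulDr : right_distributive sseries_mul +%R.
Proof.
case=> [a b] [c d] [e f]; congr SSeries => /=; first by rewrite mulrDr.
by rewrite !mulrDr addrACA.
Qed.

Lemma sseries_oner_neq0 : sseries_one != 0.
Proof. by apply/eqP => /(congr1 cf0); apply/eqP/oner_neq0. Qed.

HB.instance Definition _ := GRing.Zmodule_isNzRing.Build sseries sseries_mulA
  sseries_mul1 sseries_mulr1 sseries_mulDl sseries_mulDr sseries_oner_neq0.

Lemma sseries_scaleAl (c : rat) F G : c *: (F * G) = c *: F * G.
Proof.
case: F G => [a b] [d e]; congr SSeries => /=; first by rewrite scalerAl.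
by rewrite scalerDr fps_sparZ !scalerAl.
Qed.

Lemma sseries_scaleAr (c : rat) F G : c *: (F * G) = F * (c *: G).
Proof.
case: F G => [a b] [d e]; congr SSeries => /=; first by rewrite scalerAr.
by rewrite scalerDr !scalerAr.
Qed.

HB.instance Definition _ :=
  GRing.Lmodule_isLalgebra.Build rat sseries sseries_scaleAl.
HB.instance Definition _ :=
  GRing.Lalgebra_isAlgebra.Build rat sseries sseries_scaleAr.

Lemma cf0_sum (I : Type) (r : seq I) (P : pred I) (F : I -> sseries) :
  cf0 (\sum_(i <- r | P i) F i) = \sum_(i <- r | P i) cf0 (F i).
Proof. by elim/big_rec2: _ => // i y x _ <-. Qed.

Lemma cf1_sum (I : Type) (r : seq I) (P : pred I) (F : I -> sseries) :
  cf1 (\sum_(i <- r | P i) F i) = \sum_(i <- r | P i) cf1 (F i).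
Proof. by elim/big_rec2: _ => // i y x _ <-. Qed.

Definition sseries_homog (b : bool) F : Prop :=
  forall n, cf0 F n \in homog b /\ cf1 F n \in homog (~~ b).

Definition scst (a : R) := SSeries (Fps (fun n => a *+ (n == 0%N))) 0.
Definition sx := SSeries (Fps (fun n => (n == 1%N)%:R)) 0.
Definition sphi := SSeries 0 1.

Definition dx F := SSeries (fps_deriv (cf0 F)) (fps_deriv (cf1 F)).
Definition dphi F := SSeries (cf1 F) 0.

(* The limit of an eventually constant sequence (0 for other sequences). *)
Definition stable_lim (v : nat -> R) : R :=
  xget 0 [set l | \forall n \near \oo, v n = l]%classic.

(* The formal infinite sum: each coefficient is the eventual value of that
   coefficient in the partial sums. *)
Definition ssum (u : nat -> sseries) : sseries :=
  SSeries (Fps (fun k => stable_lim (fun n => cf0 (\sum_(i < n) u i) k)))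
          (Fps (fun k => stable_lim (fun n => cf1 (\sum_(i < n) u i) k))).

Definition sexp (T : sseries -> sseries) F : sseries :=
  ssum (fun n => (n`!%:R)^-1 *: iter n T F).

Definition opL (j : nat) F : sseries :=
  - (sx ^+ j.+1 * dx F + (j.+1%:R / 2%:R) *: (sphi * sx ^+ j * dphi F)).

(* opG j is G_{j - 1/2}. *)
Definition opG (j : nat) F : sseries :=
  - (sx ^+ j * (dphi F - sphi * dx F)).

(* Sequences indexed by j >= 1 are shifted to nat: A i and M i stand for
   A_{i+1} and M_{i+1/2}. *)
Definition opAM (A M : nat -> R) F : sseries :=
  - ssum (fun i => scst (A i) * opL i.+1 F + scst (M i) * opG i.+1 F).

(* An (even part, odd part) pair. *)
Definition spair := (sseries * sseries)%type.

Definition super_exp (A M : nat -> R) : spair :=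
  (sexp (opAM A M) sx, sexp (opAM A M) sphi).

Definition phi_mul (H : spair) : spair := (sphi * H.1, sphi * H.2).

(* With e i and m i standing for e_{i+1} and m_{i+1/2}, the pair
   (x + sum_(j >= 1) e_j x^(j+1), sum_(j >= 1) m_(j-1/2) x^j). *)
Definition coef_pair (e m : nat -> R) : spair :=
  (sx + ssum (fun i => scst (e i) * sx ^+ i.+2),
   ssum (fun i => scst (m i) * sx ^+ i.+1)).

(* H = (f + phi xi, psi + phi g). *)
Definition superconformal (H : spair) : Prop :=
  let f := cf0 H.1 in let xi := cf1 H.1 in
  let psi := cf0 H.2 in let g := cf1 H.2 in
  [/\ sseries_homog false H.1, sseries_homog true H.2, xi = g * psi,
      g ^+ 2 = fps_deriv f + psi * fps_deriv psi
    & SSeries g (fps_deriv psi) <> 0].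

Definition even_coef_phi (H : spair) : R := cf1 H.2 0%N.

End Sseries.

Section Sign.
Local Open Scope fset_scope.
Implicit Types S T U : {fset nat}.

(* M_S denotes the product of the odd variables of index in S taken in
   increasing order; then M_S M_T = osgn S T M_(S `|` T). *)
Definition oinv S T : nat := (\sum_(i <- S) \sum_(j <- T) (j < i))%N.
Definition osgn S T : rat :=
  if fdisjoint S T then ((-1) ^+ oinv S T)%R else 0%R.

Lemma big_fset_disjU (F : nat -> nat) S T : fdisjoint S T ->
  (\sum_(i <- S `|` T) F i = \sum_(i <- S) F i + \sum_(i <- T) F i)%N.
Proof.
move=> dST; rewrite -big_cat; apply: perm_big; apply: uniq_perm.
- exact: fset_uniq.
- rewrite cat_uniq !fset_uniq andbT /=; apply/hasPn => i iT.
  by apply: (fdisjointP_sym dST).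
by move=> i; rewrite mem_cat in_fsetU.
Qed.

Lemma oinvUl S T U : fdisjoint S T ->
  oinv (S `|` T) U = (oinv S U + oinv T U)%N.
Proof. exact: big_fset_disjU. Qed.

Lemma oinvUr S T U : fdisjoint T U ->
  oinv S (T `|` U) = (oinv S T + oinv S U)%N.
Proof.
by move=> d; rewrite -big_split; apply: eq_bigr => i _; apply: big_fset_disjU.
Qed.

Lemma osgnA S T U :
  (osgn S T * osgn (S `|` T) U = osgn T U * osgn S (T `|` U))%R.
Proof.
rewrite /osgn fdisjointUX fdisjointXU.
case: (boolP (fdisjoint S T)) => dST; case: (boolP (fdisjoint T U)) => dTU;
  case: (boolP (fdisjoint S U)) => dSU; rewrite /= ?mul0r ?mulr0 //.
by rewrite oinvUl // oinvUr // -!exprD addnA addnC.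
Qed.

Lemma osgn0l S : osgn fset0 S = 1%R.
Proof. by rewrite /osgn fdisjoint0X /oinv big_seq_fset0. Qed.

Lemma osgn0r S : osgn S fset0 = 1%R.
Proof.
rewrite /osgn fdisjointX0 /oinv big1 // => i _.
by rewrite big_seq_fset0.
Qed.

Lemma osgnC S T : osgn S T = ((-1) ^+ (odd #|` S| && odd #|` T|) * osgn T S)%R.
Proof.
rewrite /osgn fdisjoint_sym; case: ifP => [dTS|_]; last by rewrite mulr0.
suff e : (oinv S T + oinv T S = #|` S| * #|` T|)%N.
  rewrite -oddM -e signr_odd exprD -mulrA -exprD addnn -mul2n exprM.
  by rewrite sqrrN !expr1n mulr1.
rewrite /oinv [X in (_ + X)%N]exchange_big -big_split /=.
transitivity (\sum_(i <- S) #|` T|)%N; last first.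
  by rewrite big_const_seq count_predT iter_addn_0 mulnC.
rewrite big_seq [RHS]big_seq; apply: eq_bigr => i iS.
rewrite -big_split /= -sum1_size; rewrite big_seq [RHS]big_seq.
apply: eq_bigr => j jT; case: ltngtP => // ij.
by have := fdisjointP dTS _ jT; rewrite ij iS.
Qed.

End Sign.

(* The monomial (a, S) is the product of the A_i ^+ a i and of the M_i for i in
   S, the latter in increasing order. *)
Definition smonom := ({cmonom nat} * {fset nat})%type.

(* Q[A, M]: the free supercommutative algebra on even variables A_i and odd
   variables M_i, i : nat. *)
Definition spoly := {malg rat[smonom]}.

HB.instance Definition _ := GRing.Lmodule.copy spoly {malg rat[smonom]}.

Definition smon_mul (k l : smonom) : smonom :=
  (mmul k.1 l.1, (k.2 `|` l.2)%fset).

Definition smon1 : smonom := (mone, fset0).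

(* Locked to keep unification from unfolding products. *)
HB.lock Definition spoly_mul (f g : spoly) : spoly :=
  \sum_(k <- msupp f) \sum_(l <- msupp g)
     << f@_k * g@_l * osgn k.2 l.2 *g smon_mul k l >>.

Section Spoly.
Implicit Types (f g h : spoly) (k l : smonom) (b : bool).

Definition spoly_one : spoly := << smon1 >>.

Lemma spoly_mulw (d1 d2 : {fset smonom}) f g :
  (msupp f `<=` d1)%fset -> (msupp g `<=` d2)%fset ->
  spoly_mul f g = \sum_(k <- d1) \sum_(l <- d2)
     << f@_k * g@_l * osgn k.2 l.2 *g smon_mul k l >>.
Proof.
move=> le1 le2; rewrite spoly_mul.unlock (big_fset_incl _ le1) /=; last first.
  move=> k _ /mcoeff_outdom fk.
  by rewrite big1 // => l _; rewrite fk !mul0r monalgU0.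
apply: eq_bigr => k _; apply: big_fset_incl => // l _ /mcoeff_outdom ->.
by rewrite mulr0 mul0r monalgU0.
Qed.

Lemma spoly_mulUU (c d : rat) k l :
  spoly_mul << c *g k >> << d *g l >> =
  << c * d * osgn k.2 l.2 *g smon_mul k l >>.
Proof.
by rewrite (spoly_mulw msuppU_le msuppU_le) !big_seq_fset1 !mcoeffUU.
Qed.

Lemma spoly_mulDl : left_distributive spoly_mul +%R.
Proof.
move=> f g h.
rewrite (spoly_mulw (msuppD_le f g) (fsubset_refl (msupp h))).
rewrite (spoly_mulw (fsubsetUl _ (msupp g)) (fsubset_refl (msupp h))).
rewrite (spoly_mulw (fsubsetUr (msupp f) (msupp g)) (fsubset_refl (msupp h))).
rewrite -big_split /=; apply: eq_bigr => k _.
rewrite -big_split /=; apply: eq_bigr => l _.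
by rewrite mcoeffD !mulrDl monalgUD.
Qed.

Lemma spoly_mulDr : right_distributive spoly_mul +%R.
Proof.
move=> h f g.
rewrite (spoly_mulw (fsubset_refl (msupp h)) (msuppD_le f g)).
rewrite (spoly_mulw (fsubset_refl (msupp h)) (fsubsetUl _ (msupp g))).
rewrite (spoly_mulw (fsubset_refl (msupp h)) (fsubsetUr (msupp f) (msupp g))).
rewrite -big_split /=; apply: eq_bigr => k _.
rewrite -big_split /=; apply: eq_bigr => l _.
by rewrite mcoeffD mulrDr mulrDl monalgUD.
Qed.

Lemma spoly_mul0l g : spoly_mul 0 g = 0.
Proof. by rewrite spoly_mul.unlock msupp0 big_seq_fset0. Qed.

Lemma spoly_mul0r f : spoly_mul f 0 = 0.
Proof. by rewrite spoly_mul.unlock big1 // => k _; rewrite msupp0 big_seq_fset0. Qed.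

Lemma spoly_mul_suml (I : Type) (r : seq I) (F : I -> spoly) g :
  spoly_mul (\sum_(i <- r) F i) g = \sum_(i <- r) spoly_mul (F i) g.
Proof.
exact: (big_morph (spoly_mul^~ g) (fun f1 f2 => spoly_mulDl f1 f2 g)
          (spoly_mul0l g)).
Qed.

Lemma spoly_mul_sumr (I : Type) (r : seq I) (F : I -> spoly) g :
  spoly_mul g (\sum_(i <- r) F i) = \sum_(i <- r) spoly_mul g (F i).
Proof. exact: (big_morph (spoly_mul g) (spoly_mulDr g) (spoly_mul0r g)). Qed.

Lemma spoly_ind (P : spoly -> Prop) :
  P 0 -> (forall f g, P f -> P g -> P (f + g)) ->
  (forall c k, P << c *g k >>) -> forall f, P f.
Proof.
move=> P0 PD PU f; rewrite [f]monalgE.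
by elim/big_rec: _ => // k g _ Pg; apply: PD.
Qed.

Lemma spoly_mulA : associative spoly_mul.
Proof.
move=> f g h; elim/spoly_ind: h => [|h1 h2 e1 e2|e m].
- by rewrite !spoly_mul0r.
- by rewrite !spoly_mulDr e1 e2.
elim/spoly_ind: g => [|g1 g2 e1 e2|d l].
- by rewrite spoly_mul0l (spoly_mul0r f) spoly_mul0l.
- by rewrite spoly_mulDl !(spoly_mulDr f) spoly_mulDl e1 e2.
elim/spoly_ind: f => [|f1 f2 e1 e2|c k].
- by rewrite 3!spoly_mul0l.
- by rewrite 3!spoly_mulDl e1 e2.
transitivity (<< c * (d * e * osgn l.2 m.2) * osgn k.2 (l.2 `|` m.2)%fset
                  *g smon_mul k (smon_mul l m) >> : spoly).
  by apply: etrans (spoly_mulUU _ _ _ _); congr (spoly_mul _ _);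
     apply: spoly_mulUU.
transitivity (<< c * d * osgn k.2 l.2 * e * osgn (k.2 `|` l.2)%fset m.2
                  *g smon_mul (smon_mul k l) m >> : spoly); last first.
  by apply/esym; apply: etrans (spoly_mulUU _ _ _ _); congr (spoly_mul _ _);
     apply: spoly_mulUU.
rewrite /smon_mul /= mulmA fsetUA; congr mkmalgU.
by rewrite -!mulrA -osgnA; congr (_ * (_ * _)); rewrite mulrCA.
Qed.

Lemma spoly_mul1l : left_id spoly_one spoly_mul.
Proof.
move=> f; elim/spoly_ind: f => [|f1 f2 e1 e2|c k].
- by rewrite spoly_mul0r.
- by rewrite spoly_mulDr e1 e2.
rewrite spoly_mulUU osgn0l mul1r mulr1 /smon_mul /= mul1m fset0U.
by case: k.
Qed.

Lemma spoly_mul1r : right_id spoly_one spoly_mul.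
Proof.
move=> f; elim/spoly_ind: f => [|f1 f2 e1 e2|c k].
- by rewrite spoly_mul0l.
- by rewrite spoly_mulDl e1 e2.
rewrite spoly_mulUU osgn0r !mulr1 /smon_mul /= mulm1 fsetU0.
by case: k.
Qed.

Lemma spoly_one_neq0 : spoly_one != 0.
Proof. by rewrite monalgU_eq0 oner_eq0. Qed.

HB.instance Definition _ := GRing.Zmodule_isNzRing.Build spoly
  spoly_mulA spoly_mul1l spoly_mul1r spoly_mulDl spoly_mulDr spoly_one_neq0.

Lemma spoly_mulE f g : f * g = \sum_(k <- msupp f) \sum_(l <- msupp g)
   << f@_k * g@_l * osgn k.2 l.2 *g smon_mul k l >>.
Proof. by rewrite -[RHS](congr1 (fun m => m f g) spoly_mul.unlock). Qed.

Lemma spoly_scaleU (c d : rat) k : c *: (<< d *g k >> : spoly) = << c * d *g k >>.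
Proof.
apply/malgP => l; apply: etrans (mcoeffZ _ _ _) _.
apply: etrans (congr1 ( *%R c) (mcoeffU k d l)) _.
by apply/esym; apply: etrans (mcoeffU _ _ _) _; rewrite mulrnAr.
Qed.

Lemma spoly_scaleAl (c : rat) f g : c *: (f * g) = c *: f * g.
Proof.
elim/spoly_ind: f => [|f1 f2 e1 e2|d k].
- by rewrite mul0r !scaler0 mul0r.
- by rewrite mulrDl !scalerDr mulrDl e1 e2.
elim/spoly_ind: g => [|g1 g2 e1 e2|e l].
- by rewrite !mulr0 scaler0.
- by rewrite !mulrDr scalerDr e1 e2.
apply: etrans (congr1 ( *:%R c) (spoly_mulUU _ _ _ _)) _.
apply: etrans (spoly_scaleU _ _ _) _; apply/esym.
apply: etrans (congr1 (fun f => f * _) (spoly_scaleU _ _ _)) _.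
by apply: etrans (spoly_mulUU _ _ _ _) _; rewrite !mulrA.
Qed.

Lemma spoly_scaleAr (c : rat) f g : c *: (f * g) = f * (c *: g).
Proof.
elim/spoly_ind: f => [|f1 f2 e1 e2|d k].
- by rewrite !mul0r scaler0.
- by rewrite !mulrDl scalerDr e1 e2.
elim/spoly_ind: g => [|g1 g2 e1 e2|e l].
- by rewrite mulr0 !scaler0 mulr0.
- by rewrite mulrDr !scalerDr mulrDr e1 e2.
apply: etrans (congr1 ( *:%R c) (spoly_mulUU _ _ _ _)) _.
apply: etrans (spoly_scaleU _ _ _) _; apply/esym.
apply: etrans (congr1 (fun f => _ * f) (spoly_scaleU _ _ _)) _.
by apply: etrans (spoly_mulUU _ _ _ _) _; rewrite !mulrA [c * d]mulrC.
Qed.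

HB.instance Definition _ :=
  GRing.Lmodule_isLalgebra.Build rat spoly spoly_scaleAl.
HB.instance Definition _ :=
  GRing.Lalgebra_isAlgebra.Build rat spoly spoly_scaleAr.

Definition spoly_homog b : {pred spoly} :=
  [pred f : spoly | all (fun k : smonom => odd #|` k.2| == b) (msupp f)].

Definition spoly_part b f : spoly :=
  \sum_(k <- msupp f | odd #|` k.2| == b) << f@_k *g k >>.

Lemma spoly_homogP b f :
  reflect (forall k, odd #|` k.2| != b -> f@_k = 0) (f \in spoly_homog b).
Proof.
apply: (iffP allP) => [h k kb|h k].
  by apply/mcoeff_outdom; apply: contra kb => /h.
by rewrite -mcoeff_neq0; apply: contra_neqT => /h.
Qed.

Lemma spoly_homog_submod b : submod_closed (spoly_homog b).
Proof.
split=> [|c f g /spoly_homogP hf /spoly_homogP hg].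
  by apply/spoly_homogP => k _; rewrite mcoeff0.
by apply/spoly_homogP => k kb; rewrite mcoeffD mcoeffZ hf // hg // mulr0 addr0.
Qed.

Lemma spoly_homog_sum b (I : eqType) (r : seq I) (P : pred I) (F : I -> spoly) :
  (forall i, i \in r -> P i -> F i \in spoly_homog b) ->
  \sum_(i <- r | P i) F i \in spoly_homog b.
Proof.
case: (spoly_homog_submod b) => h0 hD hF; rewrite big_seq_cond.
elim/big_rec: _ => // i f /andP[ir Pi] hf.
by rewrite -[F i]scale1r; apply: hD => //; apply: hF.
Qed.

Lemma spoly_homogU b c k :
  odd #|` k.2| == b -> (<< c *g k >> : spoly) \in spoly_homog b.
Proof.
move=> kb; apply/spoly_homogP => l; rewrite mcoeffU.
by case: (eqVneq k l) => [<-|//]; rewrite kb.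
Qed.

Lemma spoly_homog1 : 1 \in spoly_homog false.
Proof.
by apply: (@spoly_homogU _ 1 smon1); rewrite /smon1 [X in #|` X|]/= cardfs0.
Qed.

Lemma spoly_homogM a b f g : f \in spoly_homog a -> g \in spoly_homog b ->
  f * g \in spoly_homog (a (+) b).
Proof.
move=> /allP hf /allP hg; rewrite spoly_mulE.
apply: spoly_homog_sum => k /hf /eqP ka _.
apply: spoly_homog_sum => l /hg /eqP lb _.
rewrite /osgn; case: ifP => [dkl|_]; last first.
  by rewrite mulr0 monalgU0; case: (spoly_homog_submod (a (+) b)).
apply: spoly_homogU; rewrite /= cardfsU (disjoint_fsetI0 dkl) cardfs0 subn0.
by rewrite oddD ka lb.
Qed.

Lemma spoly_part_homog b f : spoly_part b f \in spoly_homog b.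
Proof. by apply: spoly_homog_sum => k _ kb; apply: spoly_homogU. Qed.

Lemma spoly_part_sum f : f = spoly_part false f + spoly_part true f.
Proof.
rewrite {1}[f]monalgE (bigID (fun k : smonom => odd #|` k.2| == false)) /=.
by congr (_ + _); apply: eq_bigl => k; rewrite eqbF_neg negbK eqb_id.
Qed.

Lemma spoly_homog_direct f :
  f \in spoly_homog false -> f \in spoly_homog true -> f = 0.
Proof.
move=> /spoly_homogP h0 /spoly_homogP h1; apply/malgP => k; rewrite mcoeff0.
by case: (boolP (odd #|` k.2|)) => [ok|ek]; [apply: h0; rewrite ok
  | apply: h1; rewrite (negbTE ek)].
Qed.

Lemma spoly_supercomm a b f g : f \in spoly_homog a -> g \in spoly_homog b ->
  f * g = (-1) ^+ (a && b) * (g * f).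
Proof.
move=> /allP hf /allP hg.
have -> : (-1) ^+ (a && b) * (g * f) = ((-1) ^+ (a && b) : rat) *: (g * f).
  by case: (a && b); rewrite ?expr1 ?expr0 ?mulN1r ?scaleN1r ?mul1r ?scale1r.
rewrite !spoly_mulE.
rewrite [X in _ *: X]exchange_big scaler_sumr.
apply: eq_big_seq => k /hf /eqP ka; rewrite scaler_sumr.
apply: eq_big_seq => l /hg /eqP lb; apply/esym.
apply: etrans (spoly_scaleU _ _ _) _.
rewrite /smon_mul mulmC fsetUC; congr mkmalgU.
by rewrite [osgn k.2 _]osgnC ka lb mulrCA [g@_l * _]mulrC.
Qed.

HB.instance Definition _ := isSuperalgebra.Build spoly spoly_homog_submod
  spoly_homog1 spoly_homogM spoly_part_homog spoly_part_sum spoly_homog_direct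
  spoly_supercomm.

Definition Avar (i : nat) : spoly := << (ucm i, fset0) >>.
Definition Mvar (i : nat) : spoly := << (mone, [fset i]%fset) >>.

(* Substitution of A i for Avar i and of M i for Mvar i. *)
Definition spoly_subst (R : superAlgType) (A M : nat -> R) f : R :=
  \sum_(k <- msupp f) f@_k *:
    (\prod_(i <- finsupp k.1) A i ^+ k.1 i * \prod_(i <- sort leq k.2) M i).

(* univE i and univEh i are E_{i+1} and E_{i+1/2}: see universal_coefP. *)
Definition univE (i : nat) : spoly := cf0 (super_exp Avar Mvar).1 i.+2.
Definition univEh (i : nat) : spoly := cf0 (super_exp Avar Mvar).2 i.+1.

End Spoly.

Section LowCoefficients.
Variable R : superAlgType.
Implicit Types (F G : sseries R) (A M e m : nat -> R).

Lemma cf0D F G n : cf0 (F + G) n = cf0 F n + cf0 G n.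
Proof. by []. Qed.

Lemma cf1D F G n : cf1 (F + G) n = cf1 F n + cf1 G n.
Proof. by []. Qed.

Lemma cf0N F n : cf0 (- F) n = - cf0 F n.
Proof. by []. Qed.

Lemma cf1N F n : cf1 (- F) n = - cf1 F n.
Proof. by []. Qed.

Lemma cf0Z (c : rat) F n : cf0 (c *: F) n = c *: cf0 F n.
Proof. by []. Qed.

Lemma cf1Z (c : rat) F n : cf1 (c *: F) n = c *: cf1 F n.
Proof. by []. Qed.

Lemma stable_lim_eq (v : nat -> R) (l : R) (N : nat) :
  (forall n, (N <= n)%N -> v n = l) -> stable_lim v = l.
Proof.
move=> vl; have ev : \forall n \near \oo%classic, v n = l.
  by exists N => // n /=; apply: vl.
rewrite /stable_lim; case: xgetP => [l' _ [N' _ vl']|/(_ l)/(_ ev)//].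
by rewrite -(vl _ (leq_maxl N N')) (vl' (maxn N N')) //= leq_maxr.
Qed.

Lemma cf0_ssum (u : nat -> sseries R) k l N :
  (forall n, (N <= n)%N -> \sum_(i < n) cf0 (u i) k = l) -> cf0 (ssum u) k = l.
Proof.
by move=> ul; apply: (@stable_lim_eq _ _ N) => n /ul <-; rewrite cf0_sum fps_sumE.
Qed.

Lemma cf1_ssum (u : nat -> sseries R) k l N :
  (forall n, (N <= n)%N -> \sum_(i < n) cf1 (u i) k = l) -> cf1 (ssum u) k = l.
Proof.
by move=> ul; apply: (@stable_lim_eq _ _ N) => n /ul <-; rewrite cf1_sum fps_sumE.
Qed.

Lemma sphiM F : sphi R * F = SSeries 0 (cf0 F).
Proof.
congr SSeries => /=; first by rewrite mul0r.
rewrite mul1r (_ : fps_spar 0 = 0) ?mul0r ?addr0 //.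
by apply: fpsP => n /=; rewrite spar0.
Qed.

Lemma cf0_sphiM F n : cf0 (sphi R * F) n = 0.
Proof. by rewrite sphiM. Qed.

Lemma cf1_sphiM F n : cf1 (sphi R * F) n = cf0 F n.
Proof. by rewrite sphiM. Qed.

Lemma cf0_sxM F n : cf0 (sx R * F) n = if n is n'.+1 then cf0 F n' else 0.
Proof.
case: n => [|n] /=; first by rewrite big_ord1 mul0r.
rewrite big_ord_recl mul0r add0r big_ord_recl mul1r subn1 /= big1 ?addr0 //.
by move=> i _; rewrite mul0r.
Qed.

Lemma cf1_sxM F n : cf1 (sx R * F) n = if n is n'.+1 then cf1 F n' else 0.
Proof.
case: n => [|n] /=; rewrite big1 ?add0r; do ?[by move=> i _; rewrite mul0r].
  by rewrite big_ord1 spar0 mul0r.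
rewrite big_ord_recl spar0 mul0r add0r big_ord_recl spar1 mul1r subn1 /=.
by rewrite big1 ?addr0 // => i _; rewrite spar0 mul0r.
Qed.

Lemma cf0_sxnM F d n :
  cf0 (sx R ^+ d * F) n = if (n < d)%N then 0 else cf0 F (n - d)%N.
Proof.
elim: d n => [|d IH] n; first by rewrite mul1r subn0.
by rewrite exprS -mulrA cf0_sxM; case: n => // n; rewrite IH.
Qed.

Lemma cf1_sxnM F d n :
  cf1 (sx R ^+ d * F) n = if (n < d)%N then 0 else cf1 F (n - d)%N.
Proof.
elim: d n => [|d IH] n; first by rewrite mul1r subn0.
by rewrite exprS -mulrA cf1_sxM; case: n => // n; rewrite IH.
Qed.

Lemma cf0_sxn d n : cf0 (sx R ^+ d) n = (n == d)%:R.
Proof.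
rewrite -[sx R ^+ d]mulr1 cf0_sxnM; case: ltngtP => //= [lt|->].
  by rewrite subn_eq0 leqNgt lt.
by rewrite subnn.
Qed.

Lemma cf0_scstM (a : R) F n : cf0 (scst a * F) n = a * cf0 F n.
Proof.
rewrite /= big_ord_recl big1 ?addr0 ?mulr1n ?subn0 // => i _.
by rewrite mulr0n mul0r.
Qed.

Lemma cf1_scstM (a : R) F n : cf1 (scst a * F) n = spar a * cf1 F n.
Proof.
rewrite /= big1 ?add0r => [|i _]; last by rewrite mul0r.
rewrite big_ord_recl big1 ?addr0 ?mulr1n ?subn0 // => i _.
by rewrite mulr0n spar0 mul0r.
Qed.

Lemma cf0_opL_low j F n : (n <= j)%N -> cf0 (opL j F) n = 0.
Proof.
move=> nj; rewrite /opL cf0N cf0D cf0Z.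
by rewrite -mulrA cf0_sphiM cf0_sxnM ltnS nj /= scaler0 addr0 oppr0.
Qed.

Lemma cf1_opL_low j F n : (n < j)%N -> cf1 (opL j F) n = 0.
Proof.
move=> nj; rewrite /opL cf1N cf1D cf1Z.
by rewrite -mulrA cf1_sphiM cf1_sxnM cf0_sxnM ltnS (ltnW nj) nj /= scaler0 addr0 oppr0.
Qed.

Lemma cf0_opG_low j F n : (n < j)%N -> cf0 (opG j F) n = 0.
Proof. by move=> nj; rewrite /opG cf0N cf0_sxnM nj /= oppr0. Qed.

Lemma cf1_opG_low j F n : (n < j)%N -> cf1 (opG j F) n = 0.
Proof. by move=> nj; rewrite /opG cf1N cf1_sxnM nj /= oppr0. Qed.

Lemma cf0_opG_diag j F : cf1 F 0%N = 0 -> cf0 (opG j F) j = 0.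
Proof.
move=> F0; rewrite /opG cf0N cf0_sxnM ltnn subnn sphiM.
by rewrite /= F0 subr0 oppr0.
Qed.

Lemma cf0_opAM_0 A M F : cf0 (opAM A M F) 0%N = 0.
Proof.
rewrite /opAM cf0N (@cf0_ssum _ 0%N 0 0%N) ?oppr0 // => n _.
rewrite big1 // => i _; rewrite cf0D.
by rewrite !cf0_scstM cf0_opL_low // cf0_opG_low // !mulr0 addr0.
Qed.

Lemma cf1_opAM_0 A M F : cf1 (opAM A M F) 0%N = 0.
Proof.
rewrite /opAM cf1N (@cf1_ssum _ 0%N 0 0%N) ?oppr0 // => n _.
rewrite big1 // => i _; rewrite cf1D.
by rewrite !cf1_scstM cf1_opL_low // cf1_opG_low // !mulr0 addr0.
Qed.

Lemma cf0_opAM_1 A M F : cf1 F 0%N = 0 -> cf0 (opAM A M F) 1%N = 0.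
Proof.
move=> F0.
rewrite /opAM cf0N (@cf0_ssum _ 1%N 0 0%N) ?oppr0 // => n _.
rewrite big1 // => i _; rewrite cf0D.
rewrite !cf0_scstM cf0_opL_low // mulr0 add0r.
by case: (nat_of_ord i) => [|k]; rewrite ?cf0_opG_diag ?cf0_opG_low ?mulr0.
Qed.

Lemma cf0_sexp_low (T : sseries R -> sseries R) F k :
  (forall n, cf0 (iter n.+1 T F) k = 0) -> cf0 (sexp T F) k = cf0 F k.
Proof.
move=> TF; apply: (@cf0_ssum _ _ _ 1%N) => -[//|n] _.
rewrite big_ord_recl big1 ?addr0.
  by rewrite cf0Z fact0 invr1 scale1r.
by move=> i _; rewrite cf0Z TF scaler0.
Qed.

Lemma cf0_coef_pair1 e m k : cf0 (coef_pair e m).1 k =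
  if k is k'.+1 then if k' is i.+1 then e i else 1 else 0.
Proof.
rewrite [LHS]cf0D.
rewrite (@cf0_ssum _ _ (if k is i.+2 then e i else 0) k) => [|n kn].
  by case: k => [|[|k]]; rewrite /= ?addr0 ?add0r.
under eq_bigr do rewrite cf0_scstM cf0_sxn.
case: k kn => [|[|k]] kn; do ?[by rewrite big1 // => i _; rewrite mulr0].
rewrite (bigD1 (Ordinal (ltnW kn))) //= eqxx mulr1 big1 ?addr0 // => i ik.
by rewrite !eqSS eq_sym (negbTE (_ : val i != k)) ?mulr0.
Qed.

Lemma cf0_coef_pair2 e m k : cf0 (coef_pair e m).2 k =
  if k is i.+1 then m i else 0.
Proof.
apply: (@cf0_ssum _ _ _ k) => n kn.
under eq_bigr do rewrite cf0_scstM cf0_sxn.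
case: k kn => [|k] kn; first by rewrite big1 // => i _; rewrite mulr0.
rewrite (bigD1 (Ordinal kn)) //= eqxx mulr1 big1 ?addr0 // => i ik.
by rewrite eqSS eq_sym (negbTE (_ : val i != k)) ?mulr0.
Qed.

Lemma phi_mul_super_exp A M :
  phi_mul (super_exp A M) =
  phi_mul (coef_pair (fun i => cf0 (super_exp A M).1 i.+2)
                     (fun i => cf0 (super_exp A M).2 i.+1)).
Proof.
rewrite /phi_mul !sphiM; congr (SSeries 0 _, SSeries 0 _); apply: fpsP => k.
  rewrite cf0_coef_pair1; case: k => [|[|k]] //.
    by apply: etrans (cf0_sexp_low _) _ => // n; rewrite iterS cf0_opAM_0.
  apply: etrans (cf0_sexp_low _) _ => // n; rewrite iterS cf0_opAM_1 //.
  by case: n => [//|n]; rewrite iterS cf1_opAM_0.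
rewrite cf0_coef_pair2; case: k => [|k] //.
by apply: etrans (cf0_sexp_low _) _ => // n; rewrite iterS cf0_opAM_0.
Qed.

End LowCoefficients.

(* The defining equation of the universal coefficients. *)
Lemma universal_coefP :
  phi_mul (coef_pair univE univEh) = phi_mul (super_exp Avar Mvar).
Proof. by rewrite [RHS]phi_mul_super_exp. Qed.

(* Main.v *)
(* With u = sum A_j x^(j+1) and m = sum M_(j-1/2) x^j, the exponent is the even
   derivation D = u d/dx + (u'/2) phi d/dphi + m (d/dphi - phi d/dx), that is
   a + phi b |-> (u a' + m b) + phi (u b' + (u'/2) b + m a').  Let
   d = d/dphi + phi d/dx.  A pair (F, G) with F even and G odd is superconformal
   as soon as d F = G (d G) and d G <> 0.  One computes d D = (D + w) d with
   w = u'/2 + phi m' central, hence d e^D = e^(D + w) d.  As D is a derivation,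
   e^(D + w) (F G) = (e^D F) (e^(D + w) G), so that
     d (e^D x) = e^(D + w) (phi * 1) = (e^D phi) (e^(D + w) (d phi))
               = (e^D phi) (d (e^D phi)).
   All exponentials converge because D and D + w raise the weight, where x has
   weight 2 and phi has weight 1.
   Conversely phi H determines f and psi, hence g^2 = f' + psi psi'; g is the
   only even root with constant term 1, and xi = g psi.  The coefficients of
   phi H are obtained by substitution because the construction commutes with
   morphisms of superalgebras. *)
From HB Require Import structures.
From mathcomp Require Import all_boot all_order all_algebra finmap monalg.
From mathcomp Require Import boolp.
From mathcomp Require Import zify.
Require Import Defs.

Set Implicit Arguments.
Unset Strict Implicit.
Unset Printing Implicit Defensive.

Import Order.TTheory GRing.Theory Num.Theory.
Local Open Scope ring_scope.

(** * Commutation rules in a superalgebra *)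

Section Supercommutation.
Variable R : superAlgType.
Implicit Types x y z : R.

Lemma homog_even_comm x y : x \in homog false -> x * y = y * x.
Proof.
move=> hx; rewrite {1 2}(hpart_sum y) mulrDl mulrDr; congr (_ + _);
  by rewrite (supercomm _ _ _ _ hx (hpart_homog _ y)) expr0 mul1r.
Qed.

Lemma homog_odd_comm x y : x \in homog true -> y * x = x * spar y.
Proof.
move=> hx; rewrite /spar {1}(hpart_sum y) mulrDl mulrBr.
rewrite (supercomm _ _ _ _ (hpart_homog false y) hx) expr0 mul1r.
by rewrite (supercomm _ _ _ _ (hpart_homog true y) hx) expr1 mulN1r.
Qed.

Lemma homog_odd_anticomm x y :
  x \in homog true -> y \in homog true -> x * y = - (y * x).
Proof. by move=> hx hy; rewrite (supercomm _ _ _ _ hx hy) expr1 mulN1r. Qed.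

Lemma scale_natS_eq0 n x : (n.+1)%:R *: x = 0 -> x = 0.
Proof.
move=> h; rewrite -[x]scale1r -(mulVf (_ : n.+1%:R != 0 :> rat)) ?pnatr_eq0 //.
by rewrite -scalerA h scaler0.
Qed.

(** Here x x = - x x, and 2 is invertible over the rationals. *)
Lemma homog_odd_sqr x : x \in homog true -> x * x = 0.
Proof.
move=> hx; apply: (@scale_natS_eq0 1); rewrite scaler_nat mulr2n.
by rewrite {1}(homog_odd_anticomm hx hx) addNr.
Qed.

Lemma homog_sum b (I : Type) (r : seq I) (P : pred I) (F : I -> R) :
  (forall i, P i -> F i \in homog b) -> \sum_(i <- r | P i) F i \in homog b.
Proof.
move=> hF; elim/big_rec: _ => [|i y Pi hy]; first exact: homog0.
by rewrite homogD ?hF.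
Qed.

Lemma homogMn b x n : x \in homog b -> x *+ n \in homog b.
Proof. by move=> hx; rewrite -scaler_nat homogZ. Qed.

End Supercommutation.

(** * Derivation and parity for power series *)

Section FpsAlgebra.
Variable R : algType rat.
Implicit Types f g : fps R.

Lemma coefM_fps f g n : (f * g) n = \sum_(i < n.+1) f i * g (n - i)%N.
Proof. by []. Qed.

Lemma coefM_fps_rev f g n : (f * g) n = \sum_(i < n.+1) f (n - i)%N * g i.
Proof.
rewrite coefM_fps (reindex_inj rev_ord_inj) /=; apply: eq_bigr => i _.
by rewrite subSS subKn // -ltnS.
Qed.

Lemma coefD_fps f g n : (f + g) n = f n + g n. Proof. by []. Qed.
Lemma coefN_fps f n : (- f) n = - f n. Proof. by []. Qed.
Lemma coefZ_fps (c : rat) f n : (c *: f) n = c *: f n. Proof. by []. Qed.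

Lemma fps_derivD f g : fps_deriv (f + g) = fps_deriv f + fps_deriv g.
Proof. by apply: fpsP => n; apply: mulrnDl. Qed.

Lemma fps_derivZ (c : rat) f : fps_deriv (c *: f) = c *: fps_deriv f.
Proof. by apply: fpsP => n; rewrite /= scalerMnr. Qed.

Lemma fps_derivM f g : fps_deriv (f * g) = fps_deriv f * g + f * fps_deriv g.
Proof.
apply: fpsP => n.
(* The factor n+1 is shared out as i + (n+1-i); the term i = 0 then drops from the first sum and i =
   n+1 from the second. *)
have -> : fps_deriv (f * g) n =
    \sum_(i < n.+2) (f i *+ i * g (n.+1 - i)%N
                     + f i * (g (n.+1 - i)%N *+ (n.+1 - i))).
  rewrite /= -sumrMnl; apply: eq_bigr => i _.
  by rewrite mulrnAl mulrnAr -mulrnDr subnKC // -ltnS.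
rewrite big_split /=; congr (_ + _).
  rewrite big_ord_recl mulr0n mul0r add0r; apply: eq_bigr => i _.
  by rewrite /= subSS.
rewrite big_ord_recr /= subnn mulr0n mulr0 addr0; apply: eq_bigr => i _.
by rewrite subSn // -ltnS.
Qed.

End FpsAlgebra.

Section FpsTheory.
Variable R : superAlgType.
Implicit Types f g h : fps R.

Lemma fps_sparD f g : fps_spar (f + g) = fps_spar f + fps_spar g.
Proof. by apply: fpsP => n; apply: sparD. Qed.

Lemma fps_sparM f g : fps_spar (f * g) = fps_spar f * fps_spar g.
Proof.
(* Coefficient of phi in the associativity law for f, g and phi: a series that passes phi is hit by
   [fps_spar]. *)
have := congr1 (@cf1 R) (mulrA (SSeries f 0) (SSeries g 0) (SSeries 0 1)).
by rewrite /= !mul0r !mulr1 !mulr0 !add0r.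
Qed.

Lemma fps_spar_deriv f : fps_spar (fps_deriv f) = fps_deriv (fps_spar f).
Proof. by apply: fpsP => n /=; rewrite -!scaler_nat sparZ. Qed.

Lemma fps_sparK f : fps_spar (fps_spar f) = f.
Proof.
apply: fpsP => n /=.
rewrite (@spar_split _ _ (hpart false (f n)) (- hpart true (f n)))
  ?homogN ?hpart_homog //.
by rewrite opprK -hpart_sum.
Qed.

Definition fhomog b f : Prop := forall n, f n \in homog b.

Lemma fhomogD b f g : fhomog b f -> fhomog b g -> fhomog b (f + g).
Proof. by move=> hf hg n; rewrite coefD_fps homogD. Qed.

Lemma fhomogZ b (c : rat) f : fhomog b f -> fhomog b (c *: f).
Proof. by move=> hf n; rewrite coefZ_fps homogZ. Qed.

Lemma fhomogM a b f g : fhomog a f -> fhomog b g -> fhomog (a (+) b) (f * g).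
Proof. by move=> hf hg n; apply: homog_sum => i _; apply: homogM. Qed.

Lemma fhomog_deriv b f : fhomog b f -> fhomog b (fps_deriv f).
Proof. by move=> hf n; apply: homogMn. Qed.

Lemma fps_spar_even f : fhomog false f -> fps_spar f = f.
Proof. by move=> hf; apply: fpsP => n /=; rewrite spar_even. Qed.

Lemma fps_spar_odd f : fhomog true f -> fps_spar f = - f.
Proof. by move=> hf; apply: fpsP => n /=; rewrite spar_odd. Qed.

Lemma fhomog_even_comm f g : fhomog false f -> f * g = g * f.
Proof.
move=> hf; apply: fpsP => n; rewrite coefM_fps_rev; apply: eq_bigr => i _.
exact: homog_even_comm.
Qed.

Lemma fhomog_odd_comm f g : fhomog true f -> g * f = f * fps_spar g.
Proof.
move=> hf; apply: fpsP => n; rewrite coefM_fps_rev; apply: eq_bigr => i _.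
exact: homog_odd_comm.
Qed.

End FpsTheory.


(** * The weight filtration on super series *)

Section Order.
Variable R : superAlgType.
Implicit Types (f g : fps R) (F G : sseries R).

(** Orders count weight and not degree, x^n having weight 2n; the doubling leaves room for phi at
    weight 1. *)
Definition fps_ord p f : Prop := forall n, (n.*2 < p)%N -> f n = 0.

Lemma fps_ordW p q f : (q <= p)%N -> fps_ord p f -> fps_ord q f.
Proof. by move=> qp hf n nq; apply: hf; apply: leq_trans qp. Qed.

Lemma fps_ordD p f g : fps_ord p f -> fps_ord p g -> fps_ord p (f + g).
Proof. by move=> hf hg n np; rewrite coefD_fps hf // hg // addr0. Qed.

Lemma fps_ordZ p (c : rat) f : fps_ord p f -> fps_ord p (c *: f).
Proof. by move=> hf n np; rewrite coefZ_fps hf // scaler0. Qed.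

Lemma fps_ordM p q f g : fps_ord p f -> fps_ord q g -> fps_ord (p + q) (f * g).
Proof.
move=> hf hg n npq; rewrite coefM_fps big1 // => i _.
case: (ltnP i.*2 p) => ip; first by rewrite hf // mul0r.
have le_in := ltn_ord i.
by rewrite hg ?mulr0 //; lia.
Qed.

Lemma fps_ord_spar p f : fps_ord p f -> fps_ord p (fps_spar f).
Proof. by move=> hf n np; rewrite /= hf // spar0. Qed.

Lemma fps_ord_deriv p f : fps_ord p f -> fps_ord (p - 2) (fps_deriv f).
Proof. by move=> hf n np; rewrite /= hf ?mul0rn //; lia. Qed.

(* The grading in which x has weight 2 and phi has weight 1. *)
Definition ss_ord k F : Prop := fps_ord k (cf0 F) /\ fps_ord k.-1 (cf1 F).

Lemma ss_ordW k l F : (l <= k)%N -> ss_ord k F -> ss_ord l F.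
Proof.
by move=> lk [h0 h1]; split; [apply: fps_ordW h0|apply: fps_ordW h1; lia].
Qed.

Lemma ss_ordD k F G : ss_ord k F -> ss_ord k G -> ss_ord k (F + G).
Proof. by move=> [F0 F1] [G0 G1]; split; apply: fps_ordD. Qed.

Lemma ss_ordZ k (c : rat) F : ss_ord k F -> ss_ord k (c *: F).
Proof. by move=> [F0 F1]; split; apply: fps_ordZ. Qed.

Lemma ss_ordN k F : ss_ord k F -> ss_ord k (- F).
Proof. by move=> hF; rewrite -scaleN1r; apply: ss_ordZ. Qed.

Lemma ss_ord_sum k (I : Type) (r : seq I) (P : pred I) (F : I -> sseries R) :
  (forall i, P i -> ss_ord k (F i)) -> ss_ord k (\sum_(i <- r | P i) F i).
Proof.
by move=> hF; elim/big_rec: _ => // i G Pi hG; apply: ss_ordD => //; apply: hF.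
Qed.

Lemma ss_ordM k l F G : ss_ord k F -> ss_ord l G -> ss_ord (k + l) (F * G).
Proof.
move=> [F0 F1] [G0 G1]; split; first exact: fps_ordM.
apply: fps_ordD.
  by apply: fps_ordW (fps_ordM F1 G0); lia.
by apply: fps_ordW (fps_ordM (fps_ord_spar F0) G1); lia.
Qed.

Lemma ss_ord_eq F G : (forall N, ss_ord N (F - G)) -> F = G.
Proof.
move=> h; case: F G h => [a b] [c d] h; congr SSeries; apply: fpsP => n;
  (* Order 2n+2 exceeds both the weight 2n of x^n and the weight 2n+1 of phi x^n. *)
  apply/eqP; rewrite -subr_eq0; apply/eqP; case: (h n.*2.+2) => h0 h1.
  by apply: h0; lia.
by apply: h1; lia.
Qed.

End Order.

(** * Exponentials of weight-raising operators *)

Section Exponential.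
Variable R : superAlgType.
Implicit Types (T : sseries R -> sseries R) (F G : sseries R).

(** This makes the exponential converge: the n-th iterate has order n, so each coefficient is a
    finite sum. *)
Definition raises T : Prop := forall k F, ss_ord k F -> ss_ord k.+1 (T F).

Lemma raises_iter T F n : raises T -> ss_ord n (iter n T F).
Proof. by move=> hT; elim: n => // n IH; apply: hT. Qed.

Definition sexp_part T N F : sseries R :=
  \sum_(i < N) (i`!%:R)^-1 *: iter i T F.

(** Terms of index at least N have order at least N and cannot reach x^k, of weight 2k. *)
Lemma sexp_ord_cf0 T F N k : raises T -> (k.*2 < N)%N ->
  cf0 (sexp T F) k = cf0 (sexp_part T N F) k.
Proof.
move=> hT kN; apply: (@cf0_ssum _ _ _ _ N) => n Nn.
rewrite /sexp_part cf0_sum fps_sumE 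
  (big_ord_widen n (fun i => cf0 ((i`!%:R)^-1 *: iter i T F) k) Nn).
rewrite [RHS]big_mkcond; apply: eq_bigr => i _; case: ltnP => // Ni.
by case: (@raises_iter T F i hT) => h0 _; rewrite cf0Z h0 ?scaler0 //; lia.
Qed.

Lemma sexp_ord_cf1 T F N k : raises T -> (k.*2.+1 < N)%N ->
  cf1 (sexp T F) k = cf1 (sexp_part T N F) k.
Proof.
move=> hT kN; apply: (@cf1_ssum _ _ _ _ N) => n Nn.
rewrite /sexp_part cf1_sum fps_sumE 
  (big_ord_widen n (fun i => cf1 ((i`!%:R)^-1 *: iter i T F) k) Nn).
rewrite [RHS]big_mkcond; apply: eq_bigr => i _; case: ltnP => // Ni.
by case: (@raises_iter T F i hT) => _ h1; rewrite cf1Z h1 ?scaler0 //; lia.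
Qed.

Lemma sexp_ord T F N : raises T -> ss_ord N (sexp T F - sexp_part T N F).
Proof.
move=> hT; split=> n nN.
  by rewrite cf0D cf0N (sexp_ord_cf0 F hT nN) subrr.
have nN1 : (n.*2.+1 < N)%N by lia.
by rewrite cf1D cf1N (sexp_ord_cf1 F hT nN1) subrr.
Qed.

(* The generating series t |-> e^(tT) F is the solution of Y' = T Y with
   Y(0) = F, so the product rule for e^(tT) follows from the Leibniz rule. *)
Definition sexp_gen T F : fps (sseries R) :=
  Fps (fun n => (n`!%:R)^-1 *: iter n T F).

Lemma linear0ZB T : linear T ->
  [/\ T 0 = 0, forall c G, T (c *: G) = c *: T G
    & forall F G, T (F - G) = T F - T G].
Proof.
move=> hT; have T0 : T 0 = 0.
  by have := hT (-1) 0 0; rewrite scaler0 addr0 scaleN1r addNr.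
split=> // [c G|F G]; first by have := hT c G 0; rewrite addr0 T0 addr0.
by have := hT (-1) G F; rewrite !scaleN1r ![- _ + _]addrC.
Qed.

Lemma linear_bigsum T (I : Type) (r : seq I) (P : pred I) (F : I -> sseries R) :
  linear T -> T (\sum_(i <- r | P i) F i) = \sum_(i <- r | P i) T (F i).
Proof.
move=> hT; apply: big_morph; last by case: (linear0ZB hT).
by move=> F1 F2; have := hT 1 F1 F2; rewrite !scale1r.
Qed.

(** Coefficientwise form of the equation Y' = T Y. *)
Lemma sexp_genS T F n : linear T ->
  T (sexp_gen T F n) = sexp_gen T F n.+1 *+ n.+1.
Proof.
move=> hT; case: (linear0ZB hT) => _ TZ _.
rewrite /= TZ -scaler_nat scalerA factS natrM invfM mulrA mulfV ?mul1r //.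
by rewrite pnatr_eq0.
Qed.

(** Both sides solve Y' = T' Y with initial value F G, the product by the Leibniz rules for d/dt and
    for T'. *)
Lemma sexp_genM T T' F G : linear T -> linear T' ->
  (forall F G, T' (F * G) = T F * G + F * T' G) ->
  sexp_gen T' (F * G) = sexp_gen T F * sexp_gen T' G.
Proof.
move=> hT hT' TM; apply: fpsP; elim=> [|n IH].
  by rewrite /= big_ord1 /= subnn fact0 invr1 !scale1r.
have e : sexp_gen T' (F * G) n.+1 *+ n.+1 =
    (sexp_gen T F * sexp_gen T' G) n.+1 *+ n.+1.
  rewrite -sexp_genS // IH.
  apply/esym/(etrans (congr1 (fun f : fps _ => f n) (fps_derivM _ _))).
  apply/esym; rewrite (linear_bigsum _ _ _ hT') /= -big_split /=.
  apply: eq_bigr => i _.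
  by rewrite TM (sexp_genS _ _ hT) (sexp_genS _ _ hT').
(* The recursion determines coefficient n+1 because n+1 is invertible over the rationals. *)
by apply: (scalerI (_ : n.+1%:R != 0 :> rat)); rewrite ?pnatr_eq0 ?scaler_nat.
Qed.

(** This is [sexp_genM] at t = 1. The evaluation is done modulo each weight N, on polynomials in t
    truncated below t^N. *)
Lemma sexpM T T' F G : linear T -> linear T' -> raises T -> raises T' ->
  (forall F G, T' (F * G) = T F * G + F * T' G) ->
  sexp T' (F * G) = sexp T F * sexp T' G.
Proof.
move=> lT lT' rT rT' TM; apply: ss_ord_eq => N.
pose p : {poly sseries R} := \poly_(i < N) sexp_gen T F i.
pose q : {poly sseries R} := \poly_(i < N) sexp_gen T' G i.
have ep : sexp_part T N F = p.[1].
  by rewrite horner_poly; apply: eq_bigr => i _; rewrite expr1n mulr1.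
have eq : sexp_part T' N G = q.[1].
  by rewrite horner_poly; apply: eq_bigr => i _; rewrite expr1n mulr1.
have pqS : ss_ord N (sexp_part T' N (F * G) - p.[1] * q.[1]).
  (* Evaluation at 1 is multiplicative even with noncommuting coefficients, since 1 is central. *)
  rewrite -hornerM_comm; last by rewrite /comm_poly mulr1 mul1r.
  have sz : (size (p * q)%R <= N + N)%N.
    apply: leq_trans (size_polyMleq _ _) _.
    by rewrite (leq_trans (leq_pred _)) // leq_add ?size_poly.
  rewrite (horner_coef_wide 1 sz) big_split_ord /=.
  under eq_bigr => i _ do rewrite expr1n mulr1.
  under [X in _ - (_ + X)]eq_bigr => i _ do rewrite expr1n mulr1.
  (* The coefficient of t^(N+i) is a sum of products of terms of orders j and N+i-j, hence has order
     at least N; the powers below t^N agree with those of [sexp_gen T' (F * G)]. *)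
  rewrite opprD addrA; apply: ss_ordD; last first.
    apply: ss_ordN; apply: ss_ord_sum => i _; rewrite coefM.
    apply: ss_ord_sum => j _; rewrite !coef_poly.
    have jlt := ltn_ord j.
    case: ifP => _; last by rewrite mul0r.
    case: ifP => _; last by rewrite mulr0.
    have := ss_ordM (ss_ordZ (j`!%:R)^-1 (raises_iter F j rT))
      (ss_ordZ ((N + i - j)`!%:R)^-1 (raises_iter G (N + i - j) rT')).
    by apply: ss_ordW; lia.
  have -> : sexp_part T' N (F * G) = \sum_(i < N) (p * q)`_i.
    apply: eq_bigr => i _.
    rewrite -[LHS]/(sexp_gen T' (F * G) i) (sexp_genM F G lT lT' TM).
    rewrite coefM coefM_fps; apply: eq_bigr => j _; rewrite !coef_poly.
    have jlt := ltn_ord j; have ilt := ltn_ord i.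
    by rewrite !ifT //; lia.
  by rewrite subrr.
(* The difference is split into truncation errors: a', b' and c will be the partial sums. *)
have e (a b c d a' b' : sseries R) :
    a - b * d = (a - a') + ((a' - b' * c) + ((b' - b) * c + b * (c - d))).
  by rewrite mulrBl mulrBr !subrKA.
rewrite (e _ _ q.[1] _ (sexp_part T' N (F * G)) p.[1]).
apply: ss_ordD; first exact: sexp_ord.
apply: ss_ordD => //; apply: ss_ordD.
  rewrite -ep -[X in ss_ord X _]addn0; apply: ss_ordM => //.
  by rewrite -opprB; apply: ss_ordN; apply: sexp_ord.
rewrite -eq -[X in ss_ord X _]add0n; apply: ss_ordM => //.
by rewrite -opprB; apply: ss_ordN; apply: sexp_ord.
Qed.

End Exponential.

(** * The even derivation and the square root of d/dx *)

Section Vector_fields.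
Variables (R : superAlgType) (u m : fps R).
Hypotheses (u_even : fhomog false u) (m_odd : fhomog true m).
Hypotheses (u_ord : fps_ord 4 u) (m_ord : fps_ord 2 m).
Implicit Types F G : sseries R.

(* The operator u d/dx + (u'/2) phi d/dphi + m (d/dphi - phi d/dx) for odd m,
   which anticommutes with phi. *)
Definition vfield F : sseries R :=
  SSeries (u * fps_deriv (cf0 F) + m * cf1 F)
          (u * fps_deriv (cf1 F) + 2%:R^-1 *: (fps_deriv u * cf1 F)
           + m * fps_deriv (cf0 F)).

(* d/dphi + phi d/dx, a square root of d/dx. *)
Definition sderiv F : sseries R := SSeries (cf1 F) (fps_deriv (cf0 F)).

(** This is w = u'/2 + phi m', the defect in d D = (D + w) d. *)
Definition vfield_div : sseries R :=
  SSeries (2%:R^-1 *: fps_deriv u) (fps_deriv m).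

Definition vfield_twist F : sseries R := vfield F + vfield_div * F.

Lemma vfield_linear : linear vfield.
Proof.
move=> c F G; congr SSeries; rewrite /= ?fps_derivD ?fps_derivZ !mulrDr
  -!scalerAr !scalerDr.
  by rewrite addrACA.
rewrite scalerA [2%:R^-1 * c]mulrC -scalerA.
by rewrite [X in X + _ = _]addrACA [LHS]addrACA.
Qed.

Lemma vfield_twist_linear : linear vfield_twist.
Proof.
move=> c F G; rewrite /vfield_twist vfield_linear mulrDr scalerDr -scalerAr.
by rewrite addrACA.
Qed.

(** The gains in weight are 4 - 2 for u d/dx, 2 for u' phi d/dphi, 2 - 1 for m d/dphi and 2 + 1 - 2
    for m phi d/dx, all at least 1. *)
Lemma vfield_raises : raises vfield.
Proof.
move=> k F [F0 F1].
have u'_ord := fps_ord_deriv u_ord; have F0' := fps_ord_deriv F0.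
have F1' := fps_ord_deriv F1.
split; do ![apply: fps_ordD]; try apply: fps_ordZ.
- by apply: fps_ordW (fps_ordM u_ord F0'); lia.
- by apply: fps_ordW (fps_ordM m_ord F1); lia.
- by apply: fps_ordW (fps_ordM u_ord F1'); lia.
- by apply: fps_ordW (fps_ordM u'_ord F1); lia.
- by apply: fps_ordW (fps_ordM m_ord F0'); lia.
Qed.

Lemma vfield_twist_raises : raises vfield_twist.
Proof.
move=> k F hF; apply: ss_ordD; first exact: vfield_raises.
rewrite -add1n; apply: ss_ordM => //; split=> //=; apply: fps_ordZ.
by apply: fps_ordW (fps_ord_deriv u_ord).
Qed.

(** This rule and the next two bring m, u and u' to the front of each product, so that the Leibniz
    rule becomes a matter of permuting summands. *)
Lemma mul_m_swap (a b : fps R) : a * (m * b) = m * (fps_spar a * b).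
Proof. by rewrite mulrA (fhomog_odd_comm a m_odd) -mulrA. Qed.

Lemma mul_u_swap (a b : fps R) : a * (u * b) = u * (a * b).
Proof. by rewrite mulrA -(fhomog_even_comm a u_even) -mulrA. Qed.

Lemma mul_u'_swap (a b : fps R) :
  a * (fps_deriv u * b) = fps_deriv u * (a * b).
Proof.
by rewrite mulrA -(fhomog_even_comm a (fhomog_deriv u_even)) -mulrA.
Qed.

Lemma vfieldM F G : vfield (F * G) = vfield F * G + F * vfield G.
Proof.
case: F G => [a b] [c d]; congr SSeries; rewrite /= !fps_derivM.
  rewrite !mulrDl !mulrDr mul_u_swap mul_m_swap -!mulrA.
  by rewrite [RHS](AC (2*2) (1*3*(2*4))).
rewrite fps_derivD !fps_derivM fps_sparD !fps_sparM (fps_spar_even u_even).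
rewrite (fps_spar_odd m_odd) -fps_spar_deriv !mulrDl !mulrDr !mulNr !scalerDr.
rewrite -!scalerAr -!scalerAl !mul_u_swap !mul_u'_swap !mul_m_swap.
rewrite fps_sparK -!mulrA.
(* Summand 5 is minus m times the parity conjugate of b times d, from m b passing phi; summand 7 is
   its opposite, from b passing m. The other eight match the left side. *)
rewrite [RHS](AC (3*2*(2*3)) (1*6*(4*8)*(2*9)*(3*10)*(7*5))).
by rewrite /= subrr addr0.
Qed.

(** Even elements are central, and w is even because m' and phi are both odd. *)
Lemma vfield_div_comm F : F * vfield_div = vfield_div * F.
Proof.
case: F => [a b]; congr SSeries => /=.
  by rewrite -scalerAr -scalerAl (fhomog_even_comm a (fhomog_deriv u_even)).
rewrite (fhomog_odd_comm _ (fhomog_deriv m_odd)) fps_sparK addrC.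
rewrite -(fhomog_even_comm b (fhomogZ _ (fhomog_deriv u_even))).
by rewrite (fps_spar_even (fhomogZ _ (fhomog_deriv u_even))).
Qed.

(** As w is central, it can be charged to the second factor alone. *)
Lemma vfield_twistM F G :
  vfield_twist (F * G) = vfield F * G + F * vfield_twist G.
Proof.
by rewrite /vfield_twist vfieldM mulrDr -addrA mulrA -vfield_div_comm -mulrA.
Qed.

Lemma sderiv_vfield F : sderiv (vfield F) = vfield_twist (sderiv F).
Proof.
case: F => [a b]; congr SSeries; rewrite /= ?fps_derivD ?fps_derivM.
  by rewrite -scalerAl addrAC.
rewrite (fps_spar_even (fhomogZ _ (fhomog_deriv u_even))) -!scalerAl.
(* One half of u' a' belongs to the term (u'/2) phi d/dphi of D, the other half to w. *)
have {1}-> : fps_deriv u * fps_deriv a =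
    2%:R^-1 *: (fps_deriv u * fps_deriv a)
    + 2%:R^-1 *: (fps_deriv u * fps_deriv a).
  by rewrite -scalerDl (_ : _ + _ = 1 :> rat) ?scale1r.
by rewrite [LHS](AC (3*2) (3*1*5*(4*2))).
Qed.

Lemma sderiv_linear : linear sderiv.
Proof. by move=> c F G; congr SSeries; rewrite fps_derivD fps_derivZ. Qed.

Lemma sderiv_ord k F : ss_ord k F -> ss_ord k.-1 (sderiv F).
Proof.
move=> [F0 F1]; split=> //.
by apply: fps_ordW (fps_ord_deriv F0); lia.
Qed.

Lemma sderiv_sexp F : sderiv (sexp vfield F) = sexp vfield_twist (sderiv F).
Proof.
apply: ss_ord_eq => N.
(* [sderiv] lowers the weight by one, so the truncation is taken at N+1. *)
have e1 := sderiv_ord (sexp_ord F N.+1 vfield_raises).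
have e2 := ss_ordW (leqnSn N) (sexp_ord (sderiv F) N.+1 vfield_twist_raises).
have [_ sZ sB] := linear0ZB sderiv_linear.
have e : sderiv (sexp_part vfield N.+1 F) =
    sexp_part vfield_twist N.+1 (sderiv F).
  rewrite (linear_bigsum _ _ _ sderiv_linear).
  apply: eq_bigr => i _; rewrite sZ.
  by congr (_ *: _); elim: (nat_of_ord i) => //= n <-; rewrite sderiv_vfield.
move: e1 e2; rewrite sB e => e1 e2.
rewrite -(subrKA (sexp_part vfield_twist N.+1 (sderiv F))) -[X in _ + X]opprB.
by apply: ss_ordD => //; apply: ss_ordN.
Qed.

(* The superconformal condition: the square root of d/dx is homogeneous under
   the change of variables. *)
Lemma sderiv_super_exp :
  sderiv (sexp vfield (sx R)) =
  sexp vfield (sphi R) * sderiv (sexp vfield (sphi R)).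
Proof.
have dx1 : sderiv (sx R) = sphi R * 1.
  rewrite mulr1; congr SSeries; apply: fpsP => -[|n] //=.
  by rewrite mul0rn.
have dphi1 : sderiv (sphi R) = 1.
  by congr SSeries; apply: fpsP => n; rewrite /= mul0rn.
rewrite !sderiv_sexp dx1 dphi1.
exact: sexpM vfield_linear vfield_twist_linear vfield_raises
  vfield_twist_raises vfield_twistM.
Qed.

Lemma vfield_homog b F : sseries_homog b F -> sseries_homog b (vfield F).
Proof.
move=> hF; have h0 : fhomog b (cf0 F) by move=> n; case: (hF n).
have h1 : fhomog (~~ b) (cf1 F) by move=> n; case: (hF n).
have h0' := fhomog_deriv h0; have h1' := fhomog_deriv h1.
have hu' := fhomog_deriv u_even.
move=> n; split; move: n; do ![apply: fhomogD]; try apply: fhomogZ.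
- exact: (fhomogM u_even h0').
- by rewrite -[b]negbK; apply: (fhomogM m_odd h1).
- exact: (fhomogM u_even h1').
- exact: (fhomogM hu' h1).
- exact: (fhomogM m_odd h0').
Qed.

Lemma sexp_vfield_homog b F :
  sseries_homog b F -> sseries_homog b (sexp vfield F).
Proof.
move=> hF; have hi n : sseries_homog b (iter n vfield F).
  by elim: n => //= n; apply: vfield_homog.
move=> n; rewrite (sexp_ord_cf0 F vfield_raises (ltnSn _)).
rewrite (sexp_ord_cf1 F vfield_raises (ltnSn _)).
rewrite cf0_sum cf1_sum !fps_sumE; split; apply: homog_sum => i _;
  apply: homogZ; by case: (hi i n).
Qed.

End Vector_fields.

(** * The exponent as an even derivation *)

Section Coefficient_series.
Variable R : superAlgType.
Implicit Types (F G : sseries R) (A M c : nat -> R).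

(** Since [A i] goes with x^(i+2) and [M i] with x^(i+1), the series u and m are [fps_shift 2 A] and
    [fps_shift 1 M]. *)
Definition fps_shift d c : fps R :=
  Fps (fun n => if (n < d)%N then 0 else c (n - d)%N).

Lemma fps_shift_homog b d c :
  (forall i, c i \in homog b) -> fhomog b (fps_shift d c).
Proof. by move=> hc n /=; case: ifP => // _; apply: homog0. Qed.

Lemma fps_shift_ord d c : fps_ord d.*2 (fps_shift d c).
Proof. by move=> n /=; rewrite ltn_double => ->. Qed.

Lemma fps_shift_deriv d c :
  fps_deriv (fps_shift d.+1 c) = fps_shift d (fun i => c i *+ (i + d).+1).
Proof.
apply: fpsP => n /=; rewrite ltnS subSS; case: ltnP => dn.
  by rewrite mul0rn.
by rewrite subnK.
Qed.

(** The sum is indexed by the entries of c, up to any sufficient bound N, to match the partial sums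
    of the formal sum in [opAM]. *)
Lemma fps_shift_mul d c (f : fps R) n N : (n < d + N)%N ->
  (fps_shift d c * f) n =
  \sum_(i < N) c i * (if (n < i + d)%N then 0 else f (n - (i + d))%N).
Proof.
move=> nN; pose G k := fps_shift d c k * (if (n < k)%N then 0 else f (n - k)%N).
transitivity (\sum_(k < d + N) G k).
  rewrite coefM_fps.
  rewrite (big_ord_widen _ (fun k => fps_shift d c k * f (n - k)%N) nN).
  rewrite big_mkcond; apply: eq_bigr => k _; rewrite /G ltnS.
  by case: ltnP => //= _; rewrite mulr0.
rewrite big_split_ord /= big1 ?add0r => [|i _]; last first.
  by rewrite /G /= ltn_ord mul0r.
apply: eq_bigr => i _; rewrite /G /= ltnNge leq_addr /= addKn.
by rewrite [(i + d)%N]addnC.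
Qed.

Lemma cf0_vfield_term A M F i n :
  cf0 (scst (A i) * opL i.+1 F + scst (M i) * opG i.+1 F) n =
  - (A i * (if (n < i + 2)%N then 0 else fps_deriv (cf0 F) (n - (i + 2))%N)
     + M i * (if (n < i + 1)%N then 0 else cf1 F (n - (i + 1))%N)).
Proof.
rewrite cf0D !cf0_scstM /opL /opG !cf0N !mulrN -opprD.
rewrite cf0D cf0Z -mulrA cf0_sphiM scaler0 addr0 !cf0_sxnM.
by rewrite cf0D cf0N cf0_sphiM subr0 addn2 addn1.
Qed.

Lemma cf1_vfield_term A M F i n :
  A i \in homog false -> M i \in homog true ->
  cf1 (scst (A i) * opL i.+1 F + scst (M i) * opG i.+1 F) n =
  - (A i * (if (n < i + 2)%N then 0 else fps_deriv (cf1 F) (n - (i + 2))%N)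
     + 2%:R^-1 *: (A i *+ (i + 1).+1 *
          (if (n < i + 1)%N then 0 else cf1 F (n - (i + 1))%N))
     + M i * (if (n < i + 1)%N then 0 else fps_deriv (cf0 F) (n - (i + 1))%N)).
Proof.
move=> hA hM; rewrite cf1D !cf1_scstM spar_even // spar_odd // opprD.
rewrite /opL /opG !cf1N; congr (_ + _).
  rewrite mulrN cf1D mulrDr cf1_sxnM addn2; congr (- (_ + _)).
  rewrite cf1Z -mulrA cf1_sphiM cf0_sxnM addn1 -scalerAr.
  rewrite [_%:R / _]mulrC -scalerA; by rewrite scaler_nat mulrnAl.
(* The sign of M_i passing phi cancels the one in front of G; the sign that remains is that of - phi
   d/dx. *)
rewrite mulrNN -[RHS]mulrN; congr (_ * _); rewrite cf1_sxnM addn1.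
by case: ifP => _; rewrite ?oppr0 // cf1D cf1N cf1_sphiM add0r.
Qed.

Lemma opAM_vfield A M :
  (forall i, A i \in homog false) -> (forall i, M i \in homog true) ->
  opAM A M = vfield (fps_shift 2 A) (fps_shift 1 M).
Proof.
move=> hA hM; apply/funext => F.
have e0 n :
    cf0 (opAM A M F) n = cf0 (vfield (fps_shift 2 A) (fps_shift 1 M) F) n.
  rewrite /opAM cf0N; apply: (canLR (@opprK _)).
  (* Only the terms with i < n reach x^n, so the partial sums are stable from n on. *)
  apply: (@cf0_ssum _ _ _ _ n) => N nN.
  under eq_bigr => i _ do rewrite cf0_vfield_term.
  rewrite -[RHS]/(- ((fps_shift 2 A * fps_deriv (cf0 F)) n
                     + (fps_shift 1 M * cf1 F) n)).
  rewrite !(@fps_shift_mul _ _ _ n N); [|lia|lia].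
  by rewrite -big_split -sumrN.
have e1 n :
    cf1 (opAM A M F) n = cf1 (vfield (fps_shift 2 A) (fps_shift 1 M) F) n.
  rewrite /opAM cf1N; apply: (canLR (@opprK _)).
  apply: (@cf1_ssum _ _ _ _ n) => N nN.
  under eq_bigr => i _ do rewrite cf1_vfield_term //.
  rewrite -[RHS]/(- ((fps_shift 2 A * fps_deriv (cf1 F)) n
     + 2%:R^-1 *: (fps_deriv (fps_shift 2 A) * cf1 F) n
     + (fps_shift 1 M * fps_deriv (cf0 F)) n)).
  rewrite fps_shift_deriv !(@fps_shift_mul _ _ _ n N); [|lia|lia|lia].
  by rewrite scaler_sumr -!big_split -sumrN.
case: (opAM A M F) e0 e1 => [a b] e0 e1; rewrite [RHS]/vfield; congr SSeries;
  apply: fpsP => n; [exact: e0|exact: e1].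
Qed.

Lemma opAM_raises A M :
  (forall i, A i \in homog false) -> (forall i, M i \in homog true) ->
  raises (opAM A M).
Proof.
move=> hA hM; rewrite opAM_vfield //.
exact: (@vfield_raises _ _ _ (@fps_shift_ord 2 A) (@fps_shift_ord 1 M)).
Qed.

End Coefficient_series.

(** * Uniqueness of square roots *)

Section Square_roots.
Variable R : superAlgType.
Implicit Types f g : fps R.

(** Even series commute, so (f - g)(f + g) = 0, and f + g has the invertible constant term 2. *)
Lemma fps_sqr_inj f g : fhomog false f -> fhomog false g ->
  f 0%N = 1 -> g 0%N = 1 -> f ^+ 2 = g ^+ 2 -> f = g.
Proof.
move=> hf hg f0 g0 sqr_fg.
have e : (f - g) * (f + g) = 0.
  rewrite mulrBl !mulrDr -!expr2 sqr_fg (fhomog_even_comm g hf).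
  by rewrite [X in X - _]addrC subrr.
apply/eqP; rewrite -subr_eq0; apply/eqP; apply: fpsP => n.
have : forall k, (k <= n)%N -> (f - g) k = 0; last by apply.
elim: n => [|n IH] k; first by
  rewrite leqn0 => /eqP->; rewrite coefD_fps coefN_fps f0 g0 subrr.
rewrite leq_eqVlt => /orP[/eqP->|]; last exact: IH.
have /(congr1 (fun h : fps R => h n.+1)) := e.
(* The lower coefficients of f - g vanish by induction; what is left is its coefficient n+1 times
   the constant term of f + g. *)
rewrite coefM_fps big_ord_recr big1 => [|i _]; last first.
  by rewrite IH ?mul0r //= -ltnS.
rewrite /= subnn f0 g0 => h; apply: (@scale_natS_eq0 _ 1).
by rewrite scaler_nat mulr2n; move: h; rewrite mulrDr mulr1 add0r.
Qed.

End Square_roots.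

(** * Change of coefficients along an algebra morphism *)

Section Functoriality.
Variables (S R : superAlgType) (s : {lrmorphism S -> R}).
Implicit Types (F : sseries S).

Definition fps_map (f : fps S) : fps R := Fps (fun n => s (f n)).
Definition ss_map F : sseries R := SSeries (fps_map (cf0 F)) (fps_map (cf1 F)).

Lemma fps_mapM f g : fps_map (f * g) = fps_map f * fps_map g.
Proof.
apply: fpsP => n; rewrite coefM_fps /= rmorph_sum; apply: eq_bigr => i _.
exact: rmorphM.
Qed.

Lemma fps_mapD f g : fps_map (f + g) = fps_map f + fps_map g.
Proof. by apply: fpsP => n /=; rewrite raddfD. Qed.

Lemma fps_mapZ (c : rat) f : fps_map (c *: f) = c *: fps_map f.
Proof. by apply: fpsP => n /=; rewrite linearZ. Qed.

Lemma fps_map_deriv f : fps_map (fps_deriv f) = fps_deriv (fps_map f).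
Proof. by apply: fpsP => n /=; rewrite raddfMn. Qed.

Lemma fps_map_shift d c : fps_map (fps_shift d c) = fps_shift d (s \o c).
Proof. by apply: fpsP => n /=; case: ifP => // _; rewrite raddf0. Qed.

(** [vfield] is written without the parity involution, from operations that every algebra morphism
    respects coefficientwise. *)
Lemma ss_map_vfield u m F :
  ss_map (vfield u m F) = vfield (fps_map u) (fps_map m) (ss_map F).
Proof.
by rewrite /ss_map /vfield /= !(fps_mapD, fps_mapZ, fps_mapM, fps_map_deriv).
Qed.

Lemma ss_map_sx : ss_map (sx S) = sx R.
Proof.
by congr SSeries; apply: fpsP => n /=; rewrite ?raddf0 // rmorph_nat.
Qed.

Lemma ss_map_sphi : ss_map (sphi S) = sphi R.
Proof.
by congr SSeries; apply: fpsP => n /=; rewrite ?raddf0 // rmorph_nat.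
Qed.

Lemma ss_map_sexp_cf0 T T' F n : raises T -> raises T' ->
  (forall F, ss_map (T F) = T' (ss_map F)) ->
  s (cf0 (sexp T F) n) = cf0 (sexp T' (ss_map F)) n.
Proof.
(* Truncation replaces the infinite sums by finite ones, with which s commutes. *)
move=> rT rT' sT; rewrite (sexp_ord_cf0 F rT (ltnSn _)).
rewrite (sexp_ord_cf0 _ rT' (ltnSn _)) !cf0_sum !fps_sumE linear_sum.
apply: eq_bigr => i _; rewrite !cf0Z linearZ /=; congr (_ *: _).
have -> : iter i T' (ss_map F) = ss_map (iter i T F); last by [].
by elim: (nat_of_ord i) => //= k ->; rewrite sT.
Qed.

End Functoriality.

(** * Ordered monomials and substitution *)

Lemma fset_min_ind (P : {fset nat} -> Prop) :
  P fset0 ->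
  (forall i S, (forall j, j \in S -> (i < j)%N) -> P S -> P (i |` S)%fset) ->
  forall S, P S.
Proof.
move=> P0 PU S.
(* A set is rebuilt from the end of its increasing list, so each inserted element is a new minimum;
   for ordered odd monomials this prepends one variable. *)
have Ps s : sorted ltn s -> P [fset x in s]%fset.
  elim: s => [|i s IH] /= hs.
    rewrite (_ : [fset x in _]%fset = fset0) //.
    by apply/fsetP => x; rewrite !inE.
  rewrite (_ : [fset x in _]%fset = i |` [fset x in s])%fset; last first.
    by apply/fsetP => x; rewrite !inE.
  apply: PU => [j|]; last by apply: IH; apply: path_sorted hs.
  by rewrite inE => /(allP (order_path_min ltn_trans hs)).
rewrite (_ : S = [fset x in sort leq S])%fset.
  apply: Ps; rewrite ltn_sorted_uniq_leq sort_uniq fset_uniq /=.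
  exact: (sort_sorted leq_total).
by apply/fsetP => x; rewrite inE mem_sort.
Qed.

Lemma osgn_lt i S :
  (forall j, j \in S -> (i < j)%N) -> osgn [fset i]%fset S = 1.
Proof.
move=> iS; rewrite /osgn ifT; last first.
  by rewrite fdisjoint1X; apply/negP => /iS; rewrite ltnn.
rewrite /oinv big_seq_fset1 big_seq big1 // => j /iS ij.
by rewrite ltnNge (ltnW ij).
Qed.

(** Exchanging M_i and M_j costs one sign: [osgnA] for ({j}, {i}, S) and for ({i}, {j}, S) relates
    both sides to the sign of {i, j} against S. *)
Lemma osgn_gt i j S : (j < i)%N -> (forall k, k \in S -> (j < k)%N) ->
  osgn [fset i]%fset (j |` S)%fset = - osgn [fset i]%fset S.
Proof.
move=> ji jS.
have j_i : osgn [fset j]%fset [fset i]%fset = 1.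
  by apply: osgn_lt => k; rewrite inE => /eqP->.
have i_j : osgn [fset i]%fset [fset j]%fset = -1.
  by rewrite osgnC j_i !cardfs1 expr1 mulr1.
have := osgnA [fset j]%fset [fset i]%fset S.
rewrite j_i mul1r [X in _ * X]osgn_lt ?mulr1 => [<-|k]; last first.
  by rewrite !inE => /orP[/eqP->|/jS].
have := osgnA [fset i]%fset [fset j]%fset S.
by rewrite i_j mulN1r [osgn [fset j]%fset S]osgn_lt // mul1r fsetUC => ->.
Qed.

Section Substitution.
Variables (R : superAlgType) (A M : nat -> R).
Hypotheses (hA : forall i, A i \in homog false).
Hypotheses (hM : forall i, M i \in homog true).
Implicit Types (S T : {fset nat}) (k l : {cmonom nat}) (f g : spoly).

Definition odd_mon S : R := \prod_(i <- sort leq S) M i.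
Definition even_mon k : R := \prod_(i <- finsupp k) A i ^+ k i.

Lemma odd_mon0 : odd_mon fset0 = 1.
Proof.
rewrite /odd_mon; have -> : sort leq (fset0 : {fset nat}) = [::].
  by apply: size0nil; rewrite size_sort cardfs0.
by rewrite big_nil.
Qed.

Lemma odd_monU1 i S : (forall j, j \in S -> (i < j)%N) ->
  odd_mon (i |` S)%fset = M i * odd_mon S.
Proof.
move=> iS; rewrite /odd_mon.
have -> : sort leq (i |` S)%fset = i :: sort leq S; last by rewrite big_cons.
apply: (sorted_eq leq_trans anti_leq); first exact: (sort_sorted leq_total).
  rewrite /= path_min_sorted; first exact: (sort_sorted leq_total).
  by apply/allP => j; rewrite mem_sort => /iS /ltnW.
rewrite perm_sort; apply: uniq_perm; first exact: fset_uniq.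
  rewrite /= mem_sort sort_uniq fset_uniq andbT.
  by apply/negP => /iS; rewrite ltnn.
by move=> j; rewrite in_cons mem_sort in_fset1U.
Qed.

(** Insertion into an ordered product: M_i moves right past the smaller indices, changing sign each
    time. *)
Lemma mul_odd_mon1 i T :
  M i * odd_mon T = osgn [fset i]%fset T *: odd_mon (i |` T)%fset.
Proof.
elim/fset_min_ind: T => [|j T jT IH].
  by rewrite osgn0r scale1r odd_monU1 // odd_mon0.
case: (ltngtP i j) => [ij|ji|ij].
- have iT x : x \in (j |` T)%fset -> (i < x)%N.
    by rewrite !inE => /orP[/eqP->//|/jT]; apply: ltn_trans.
  by rewrite osgn_lt // scale1r [in RHS]odd_monU1.
- rewrite odd_monU1 // mulrA (homog_odd_anticomm (hM i) (hM j)) mulNr -mulrA IH.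
  rewrite osgn_gt // -scalerAr scaleNr; congr (- (_ *: _)).
  rewrite [(i |` (j |` T))%fset]fsetUCA [RHS]odd_monU1 // => x.
  by rewrite !inE => /orP[/eqP->|/jT].
(* A repeated index: M_i squares to 0, and [osgn] vanishes on sets that meet. *)
rewrite -ij in jT *.
rewrite odd_monU1 // mulrA (homog_odd_sqr (hM i)) mul0r.
by rewrite /osgn fdisjoint1X !inE eqxx /= scale0r.
Qed.

Lemma mul_odd_mon S T :
  odd_mon S * odd_mon T = osgn S T *: odd_mon (S `|` T)%fset.
Proof.
elim/fset_min_ind: S => [|i S iS IH].
  by rewrite odd_mon0 mul1r osgn0l scale1r fset0U.
rewrite odd_monU1 // -mulrA IH -scalerAr mul_odd_mon1 scalerA -osgnA.
by rewrite osgn_lt // mul1r fsetUA.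
Qed.

(** R is not commutative, so products of powers of the A_i are rearranged through the centrality of
    each factor. *)
Definition central (x : R) : Prop := forall y, x * y = y * x.

Lemma central_prod (r : seq nat) (F : nat -> R) :
  (forall i, central (F i)) -> central (\prod_(i <- r) F i).
Proof.
move=> hF y; elim: r => [|i r IH]; first by rewrite big_nil mul1r mulr1.
by rewrite big_cons -mulrA IH !mulrA hF.
Qed.

Lemma central_prod_perm (r1 r2 : seq nat) (F : nat -> R) :
  (forall i, central (F i)) -> perm_eq r1 r2 ->
  \prod_(i <- r1) F i = \prod_(i <- r2) F i.
Proof.
move=> hF r12; pose P r := \prod_(i <- r1) F i = \prod_(i <- r) F i.
(* It suffices to exchange the two leading blocks of a list; such exchanges generate all
   permutations. *)
apply: (@catCA_perm_ind _ P _ r1 r2) => // s1 s2 s3.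
rewrite /P => ->; rewrite !big_cat /= !mulrA; congr (_ * _).
exact: central_prod.
Qed.

Lemma central_prodM (r : seq nat) (F G : nat -> R) :
  (forall i, central (F i)) -> (forall i, central (G i)) ->
  \prod_(i <- r) (F i * G i) = \prod_(i <- r) F i * \prod_(i <- r) G i.
Proof.
move=> hF hG; elim: r => [|i r IH]; first by rewrite !big_nil mulr1.
by rewrite !big_cons IH -!mulrA; congr (_ * _); rewrite !mulrA hG.
Qed.

Lemma central_evenX i n : central (A i ^+ n).
Proof.
move=> y; elim: n => [|n IH]; first by rewrite mul1r mulr1.
by rewrite exprS -mulrA IH mulrA (homog_even_comm _ (hA i)) mulrA.
Qed.

(** Factors outside the support of k are A_i^0 = 1, so two monomials can be multiplied over the
    union of their supports. *)
Lemma even_monE k (d : {fset nat}) : (finsupp k `<=` d)%fset ->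
  even_mon k = \prod_(i <- d) A i ^+ k i.
Proof.
move=> kd.
rewrite [RHS](eq_bigr (fun i => if i \in finsupp k then A i ^+ k i else 1))
  => [|i _].
  rewrite -big_mkcond -big_filter; apply: central_prod_perm => [i|].
    exact: central_evenX.
  apply: uniq_perm; rewrite ?filter_uniq ?fset_uniq // => i.
  by rewrite mem_filter; case: (boolP (i \in finsupp k)) => // /(fsubsetP kd).
by case: finsuppP => // _; rewrite expr0.
Qed.

Lemma mul_even_mon k l : even_mon k * even_mon l = even_mon (mmul k l).
Proof.
rewrite (even_monE (fsubsetUl _ (finsupp l))).
rewrite (even_monE (fsubsetUr (finsupp k) _)).
rewrite -central_prodM; do ?[by move=> i; apply: central_evenX].
rewrite (even_monE (d := finsupp k `|` finsupp l)%fset) ?mdomD //.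
by apply: eq_bigr => i _; rewrite cmM exprD.
Qed.

Lemma even_mon_central k : central (even_mon k).
Proof. by apply: central_prod => i; apply: central_evenX. Qed.

Lemma scale_monM (c d : rat) k l S T :
  (c *: (even_mon k * odd_mon S)) * (d *: (even_mon l * odd_mon T)) =
  (c * d * osgn S T) *: (even_mon (mmul k l) * odd_mon (S `|` T)%fset).
Proof.
rewrite -(scalerAl c) -(scalerAr d) !scalerA -(scalerA (c * d)); congr (_ *: _).
rewrite mulrA -[even_mon k * _ * _]mulrA -even_mon_central mulrA mul_even_mon.
by rewrite -mulrA mul_odd_mon scalerAr.
Qed.

Lemma spoly_substE f (d : {fset smonom}) : (msupp f `<=` d)%fset ->
  spoly_subst A M f = \sum_(k <- d) f@_k *: (even_mon k.1 * odd_mon k.2).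
Proof.
by move=> fd; apply: big_fset_incl => // k _ /mcoeff_outdom ->; rewrite scale0r.
Qed.

Lemma spoly_substU (c : rat) (k : smonom) :
  spoly_subst A M << c *g k >> = c *: (even_mon k.1 * odd_mon k.2).
Proof. by rewrite (spoly_substE msuppU_le) big_seq_fset1 mcoeffUU. Qed.

Lemma spoly_subst_linear : linear (spoly_subst A M).
Proof.
move=> c f g; pose d := (msupp f `|` msupp g `|` msupp (c *: f + g))%fset.
have fd : (msupp f `<=` d)%fset by rewrite /d -fsetUA fsubsetUl.
have gd : (msupp g `<=` d)%fset by rewrite /d fsetUAC fsubsetUr.
rewrite (spoly_substE fd) (spoly_substE gd) (@spoly_substE _ d) ?fsubsetUr //.
rewrite scaler_sumr -big_split; apply: eq_bigr => k _.
by rewrite mcoeffD mcoeffZ scalerDl scalerA.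
Qed.

Lemma spoly_substD f g :
  spoly_subst A M (f + g) = spoly_subst A M f + spoly_subst A M g.
Proof. by have := spoly_subst_linear 1 f g; rewrite !scale1r. Qed.

Lemma spoly_subst0 : spoly_subst A M 0 = 0.
Proof. by rewrite (@spoly_substE _ fset0) ?big_seq_fset0 ?msupp0. Qed.

Lemma spoly_substM f g :
  spoly_subst A M (f * g) = spoly_subst A M f * spoly_subst A M g.
Proof.
elim/spoly_ind: f => [|f1 f2 e1 e2|c k].
- by rewrite mul0r spoly_subst0 mul0r.
- by rewrite mulrDl !spoly_substD e1 e2 mulrDl.
elim/spoly_ind: g => [|g1 g2 e1 e2|d l].
- by rewrite mulr0 spoly_subst0 mulr0.
- by rewrite mulrDr !spoly_substD e1 e2 mulrDr.
apply: etrans (congr1 (spoly_subst A M) (spoly_mulUU _ _ _ _)) _.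
apply: etrans (spoly_substU _ _) _.
apply/esym; apply: etrans (congr2 *%R (spoly_substU _ _) (spoly_substU _ _)) _.
exact: scale_monM.
Qed.

Lemma spoly_subst1 : spoly_subst A M 1 = 1.
Proof.
rewrite (spoly_substU 1 smon1) scale1r /smon1 /= odd_mon0 mulr1.
by rewrite /even_mon mdom1 big_seq_fset0.
Qed.

Lemma spoly_subst_Avar i : spoly_subst A M (Avar i) = A i.
Proof.
rewrite (spoly_substU 1 (ucm i, fset0)) scale1r /= odd_mon0 mulr1.
by rewrite /even_mon mdomU big_seq_fset1 cmUU expr1.
Qed.

Lemma spoly_subst_Mvar i : spoly_subst A M (Mvar i) = M i.
Proof.
rewrite (spoly_substU 1 (mone, [fset i]%fset)) scale1r /=.
rewrite /even_mon mdom1 big_seq_fset0 mul1r.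
by rewrite -[[fset i]%fset]fsetU0 odd_monU1 // odd_mon0 mulr1.
Qed.

End Substitution.

(** * Specialisation of the universal coefficients *)

Lemma spoly_subst_lrmorphism (R : superAlgType) (A M : nat -> R) :
  (forall i, A i \in homog false) -> (forall i, M i \in homog true) ->
  exists s : {lrmorphism spoly -> R}, s =1 spoly_subst A M.
Proof.
move=> hA hM.
(* Multiplicativity rests on the parities of A and M, so the morphism structure is built under these
   hypotheses. *)
by exists (HB.pack_for {lrmorphism spoly -> R} (spoly_subst A M)
  (GRing.isLinear.Build rat spoly R *:%R (spoly_subst A M)
     (spoly_subst_linear A M))
  (GRing.isMonoidMorphism.Build spoly R (spoly_subst A M)
     (spoly_subst1 A M, spoly_substM hA hM))).
Qed.

Lemma rmorph_super_exp (S R : superAlgType) (s : {lrmorphism S -> R})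
    (A M : nat -> S) (A' M' : nat -> R) :
  (forall i, A i \in homog false) -> (forall i, M i \in homog true) ->
  (forall i, A' i \in homog false) -> (forall i, M' i \in homog true) ->
  (forall i, s (A i) = A' i) -> (forall i, s (M i) = M' i) ->
  forall n,
  s (cf0 (super_exp A M).1 n) = cf0 (super_exp A' M').1 n /\
  s (cf0 (super_exp A M).2 n) = cf0 (super_exp A' M').2 n.
Proof.
move=> hA hM hA' hM' sA sM n.
have sT F : ss_map s (opAM A M F) = opAM A' M' (ss_map s F).
  rewrite !opAM_vfield // ss_map_vfield !fps_map_shift.
  by congr (vfield (fps_shift _ _) (fps_shift _ _) _); apply/funext.
have rS := opAM_raises hA hM; have rR := opAM_raises hA' hM'.
by rewrite !(ss_map_sexp_cf0 _ _ rS rR sT) ss_map_sx ss_map_sphi.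
Qed.

Lemma Avar_even i : Avar i \in homog false.
Proof.
by apply: (@spoly_homogU _ 1 (ucm i, fset0)); rewrite [X in #|` X|]/= cardfs0.
Qed.

Lemma Mvar_odd i : Mvar i \in homog true.
Proof.
apply: (@spoly_homogU _ 1 (mone, [fset i]%fset)).
by rewrite [X in #|` X|]/= cardfs1.
Qed.

(** Naturality of the exponential, applied to the morphism that sends the generic variables to A and
    M. *)
Lemma super_exp_coef_subst (R : superAlgType) (A M : nat -> R) :
  (forall i, A i \in homog false) -> (forall i, M i \in homog true) ->
  forall n,
  spoly_subst A M (cf0 (super_exp Avar Mvar).1 n) = cf0 (super_exp A M).1 n /\
  spoly_subst A M (cf0 (super_exp Avar Mvar).2 n) = cf0 (super_exp A M).2 n.
Proof.
move=> hA hM n; have [s sE] := spoly_subst_lrmorphism hA hM.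
have sA i : s (Avar i) = A i by rewrite sE spoly_subst_Avar.
have sM i : s (Mvar i) = M i by rewrite sE spoly_subst_Mvar.
have [e1 e2] := rmorph_super_exp Avar_even Mvar_odd hA hM sA sM n.
by split; apply: etrans (esym (sE _)) _; [exact: e1|exact: e2].
Qed.

(** * Superconformality and uniqueness *)

Lemma superconformal_super_exp (R : superAlgType) (A M : nat -> R) :
  (forall i, A i \in homog false) -> (forall i, M i \in homog true) ->
  superconformal (super_exp A M) /\ even_coef_phi (super_exp A M) = 1.
Proof.
move=> hA hM.
have hu := fps_shift_homog 2 hA; have hm := fps_shift_homog 1 hM.
have ou := @fps_shift_ord _ 2 A; have om := @fps_shift_ord _ 1 M.
(* Values of [opAM] have no term in phi x^0, so only the term phi of index 0 contributes. *)
have g0 : cf1 (sexp (opAM A M) (sphi R)) 0%N = 1.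
  apply: (@cf1_ssum _ _ _ _ 1%N) => -[//|n] _.
  rewrite big_ord_recl big1 ?addr0 => [|i _].
    by rewrite cf1Z fact0 invr1 scale1r.
  by rewrite cf1Z iterS cf1_opAM_0 scaler0.
split; last exact: g0.
have hx : sseries_homog false (sx R).
  move=> n; split=> /=; last exact: homog0.
  by case: eqP => _; [apply: homog1|apply: homog0].
have hphi : sseries_homog true (sphi R).
  move=> n; split=> /=; first exact: homog0.
  by case: eqP => _; [apply: homog1|apply: homog0].
have h1 := sexp_vfield_homog hu hm ou om hx.
have h2 := sexp_vfield_homog hu hm ou om hphi.
move: g0 (sderiv_super_exp hu hm ou om) h1 h2.
rewrite /super_exp opAM_vfield //.
case: (sexp _ (sphi R)) => [psi g]; case: (sexp _ (sx R)) => [f xi] /=.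
move=> g0 e h1 h2.
have hpsi : fhomog true psi by move=> n; case: (h2 n).
have hg : fhomog false g by move=> n; case: (h2 n).
(* The two components of d (e^D x) = (e^D phi) (d (e^D phi)); since psi is odd, passing phi gives
   the sign that turns the second into g^2 = f' + psi psi'. *)
have exi : xi = psi * g := congr1 (@cf0 R) e.
have ef : fps_deriv f = g * g + fps_spar psi * fps_deriv psi :=
  congr1 (@cf1 R) e.
split=> //=.
- by rewrite exi (fhomog_even_comm _ hg).
- by rewrite ef (fps_spar_odd hpsi) mulNr addrNK expr2.
(* Nondegeneracy is visible on the constant term g(0) = 1. *)
move=> /(congr1 (fun F => cf0 F 0%N)) /= /eqP.
by rewrite g0 oner_eq0.
Qed.

Lemma superconformal_inj (R : superAlgType) (H K : spair R) :
  superconformal H -> superconformal K ->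
  even_coef_phi H = 1 -> even_coef_phi K = 1 ->
  phi_mul H = phi_mul K -> H = K.
Proof.
case: H K => [[f xi] [psi g]] [[f' xi'] [psi' g']].
rewrite /superconformal /even_coef_phi /phi_mul !sphiM /=.
move=> [_ h2 -> sq _] [_ h2' -> sq' _] g0 g0' [ef epsi]; subst f' psi'.
(* With f and psi shared, g and g' are even square roots of the same series with constant term 1. *)
have -> : g = g'; last by [].
apply: fps_sqr_inj g0 g0' _ => [n|n|]; [by case: (h2 n)|by case: (h2' n)|].
by rewrite sq sq'.
Qed.

Theorem proposition3p5 (R : superAlgType) (A M : nat -> R)
    (hA : forall i, A i \in @homog R false)
    (hM : forall i, M i \in @homog R true) :
  let H := super_exp A M in
  let E i := spoly_subst A M (univE i) in
  let Eh i := spoly_subst A M (univEh i) in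
  superconformal H /\
  unique (fun K : spair R =>
            [/\ superconformal K, even_coef_phi K = 1
              & phi_mul K = phi_mul (coef_pair E Eh)]) H.
Proof.
move=> H E Eh; have [scH H1] := superconformal_super_exp hA hM.
have eE : E = fun i => cf0 (super_exp A M).1 i.+2.
  by apply/funext => i; case: (super_exp_coef_subst hA hM i.+2).
have eEh : Eh = fun i => cf0 (super_exp A M).2 i.+1.
  by apply/funext => i; case: (super_exp_coef_subst hA hM i.+1).
have HE : phi_mul H = phi_mul (coef_pair E Eh).
  (* [phi_mul_super_exp] supplies the normalisation of H: its f starts with x and its psi has no
     constant term. *)
  by rewrite eE eEh; apply: phi_mul_super_exp.
clearbody E Eh.
split=> //; split=> // K [scK K1 KE].
by apply: superconformal_inj => //; rewrite HE KE.
Qed.
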